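(* Let $M$ be a cactus configuration on the ground set $[d]$. Then the circuit variety $V_{\mathcal C(M)}$ has at most $2^{|Q_M|}$ irreducible components, each obtained from $M$ by setting a subset of $Q_M$ to be loops; that is, each irreducible component of $V_{\mathcal C(M)}$ is of the form $V_{M(J)}$ for some $J\subset Q_M$.
   Context: A point-line configuration is a simple matroid of rank at most three on a finite ground set, say $[d]=\{1,\dots,d\}$. Its elements are called points. A line is a maximal dependent subset with at least three elements all of whose three-element subsets are circuits; $\mathcal L_M$ is the set of lines and $\mathcal L_p$ the set of lines containing the point $p$; the degree of $p$ is $|\mathcal L_p|$. $Q_M$ is the set of points of degree at least three. For $J\subset[d]$, $M(J)$ is the matroid on $[d]$ obtained from $M$ by setting the points of $J$ to be loops: its circuits are the inclusion-minimal elements of $\mathcal C(M)\cup\{\{s\}:s\in J\}$, where $\mathcal C(M)$ is the set of circuits of $M$. For a matroid $N$ of rank at most three on $[d]$: $\Gamma_N$ is the set of $\gamma=(\gamma_1,\dots,\gamma_d)\in(\mathbb C^3)^d$ such that a subset of $[d]$ is dependent in $N$ if and only if the corresponding vectors $\gamma_i$ are linearly dependent; $V_N$ is the Zariski closure of $\Gamma_N$; the circuit variety $V_{\mathcal C(N)}$ is the set of $\gamma\in(\mathbb C^3)^d$ such that for every dependent set of $N$ the corresponding vectors are linearly dependent. Cycle: a point-line configuration with $n$ lines is a cycle if there are points $p_1,\dots,p_n$ and an ordering $l_1,\dots,l_n$ of its lines such that each $p_i$ lies on precisely two lines, namely $l_i$ and $l_{i+1}$ (with $l_{n+1}=l_1$),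 and every other point lies on exactly one line. Free gluing: for point-line configurations $M$ on $[d_1]$, $N$ on $[d_2]$ and points $p\in[d_1]$, $q\in[d_2]$, the free gluing $M\amalg_{p,q}N$ is the point-line configuration on the disjoint union of the two ground sets with $p$ and $q$ identified to one point $P$, whose lines are exactly the lines of $M$ and the lines of $N$ (with $p$, $q$ replaced by $P$). Cactus: a connected cactus configuration is a point-line configuration $M$ for which there is a sequence $N_1,\dots,N_k=M$ such that $N_1$ is a single line (i.e. $U_{2,m}$ with $m\ge 3$) or a cycle, and each $N_{i+1}$ is a free gluing of $N_i$ with a line or a cycle. A cactus configuration is a point-line configuration each of whose connected components (restrictions to the classes of the equivalence relation on points generated by lying on a common line) is a connected cactus configuration. *)

(* Defs.v *)
From HB Require Import structures.
From mathcomp Require Import all_boot all_order all_algebra.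

Set Implicit Arguments.
Unset Strict Implicit.
Unset Printing Implicit Defensive.

Import GRing.Theory.

Section Matroids.
Local Open Scope set_scope.

Record matroid (T : finType) := Matroid {
  indep : {set {set T}};
  indep0 : set0 \in indep;
  indepS : forall I J : {set T}, I \subset J -> J \in indep -> I \in indep;
  indep_aug : forall I J : {set T}, I \in indep -> J \in indep ->
    #|I| < #|J| -> exists2 x, x \in J :\: I & x |: I \in indep
}.

Variable T : finType.
Implicit Types (M : matroid T) (A C I J L : {set T}).

Definition dependent M A : bool := A \notin indep M.

Definition circuits M : {set {set T}} := [set C | minset (dependent M) C].

Definition rank M : nat := \max_(I in indep M) #|I|.

(* No loops and no parallel elements. *)
Definition simple_matroid M : bool :=
  [forall C in circuits M, 2 < #|C|].

Definition point_line_config M : bool := simple_matroid M && (rank M <= 3).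

Definition line_like M : pred {set T} := [pred A |
  [&& dependent M A, 2 < #|A| &
      [forall C : {set T}, (C \subset A) && (#|C| == 3) ==> (C \in circuits M)]]].

Definition lines M : {set {set T}} := [set L | maxset (line_like M) L].

Definition lines_at M (x : T) : {set {set T}} := [set L in lines M | x \in L].

Definition degree M (x : T) : nat := #|lines_at M x|.

Definition Qset M : {set T} := [set x | 2 < degree M x].

Definition loops_circuits M J : {set {set T}} :=
  [set C | minset (mem (circuits M :|: [set [set s] | s in J])) C].

Definition loops_indep M J : {set {set T}} :=
  [set I : {set T} | [forall C in loops_circuits M J, ~~ (C \subset I)]].

Lemma loops_indepE M J I :
  (I \in loops_indep M J) = (I \in indep M) && [disjoint I & J].
Proof.
rewrite inE; apply/forall_inP/andP => [noC | [indI disIJ] C].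
  have noS B : B \in circuits M :|: [set [set s] | s in J] -> ~~ (B \subset I).
    move=> SB; have [C minC sCB] := minset_exists (P := mem _) SB.
    by apply: contra (noC C _); [apply: subset_trans | rewrite inE].
  split.
    apply: contraT => depI.
    have [C minC sCI] := minset_exists (P := dependent M) depI.
    by have := noS C; rewrite sCI !inE minC => /(_ isT).
  rewrite disjoint_subset; apply/subsetP => x Ix; rewrite inE.
  apply/negP => Jx; have := noS [set x].
  by rewrite sub1set Ix inE imset_f ?orbT // => /(_ isT).
rewrite inE => /minsetp/setUP[|].
  rewrite inE => /minsetp; apply: contra => sCI.
  exact: indepS sCI indI.
case/imsetP => s Js ->; rewrite sub1set; apply/negP => Is.
by move/disjointFr: disIJ => /(_ s Is); rewrite Js.
Qed.

Fact loops_indep0 M J : set0 \in loops_indep M J.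
Proof. by rewrite loops_indepE indep0 -setI_eq0 set0I eqxx. Qed.

Fact loops_indepS M J I I' :
  I \subset I' -> I' \in loops_indep M J -> I \in loops_indep M J.
Proof.
move=> sII'; rewrite !loops_indepE => /andP[indI' disI'].
by rewrite (indepS sII' indI') (disjointWl sII' disI').
Qed.

Fact loops_indep_aug M J I I' :
  I \in loops_indep M J -> I' \in loops_indep M J -> #|I| < #|I'| ->
  exists2 x, x \in I' :\: I & x |: I \in loops_indep M J.
Proof.
rewrite !loops_indepE => /andP[indI disI] /andP[indI' disI'] ltI.
have [x xI' indxI] := indep_aug indI indI' ltI.
exists x => //; rewrite loops_indepE indxI -setI_eq0 setIUl setU_eq0.
rewrite !setI_eq0 disI disjoints1 andbT.
by move: xI'; rewrite inE => /andP[_ /(disjointFr disI') ->].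
Qed.

(* M(J): the matroid whose circuits are the elements of [loops_circuits M J];
   see [circuits_set_loops]. *)
Definition set_loops M J : matroid T :=
  Matroid (loops_indep0 M J) (@loops_indepS M J) (@loops_indep_aug M J).

Lemma circuits_set_loops M J : circuits (set_loops M J) = loops_circuits M J.
Proof.
have depP A : reflect (exists2 C, C \in loops_circuits M J & C \subset A)
                (dependent (set_loops M J) A).
  rewrite /dependent inE negb_forall_in.
  by apply: (iffP exists_inP) => [] [C cC sCA]; exists C; rewrite ?negbK // in sCA *.
apply/setP => C; rewrite inE; apply/minsetP/idP => [[/depP[B cB sBC] minC] | cC].
  by rewrite -(minC B) //; apply/depP; exists B.
split; first by apply/depP; exists C.
move=> B /depP[D cD sDB] sBC; apply/eqP; rewrite eqEsubset sBC /=.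
suff -> : C = D by [].
apply/esym; move: cC cD; rewrite !inE => /minsetP[_ minC] /minsetp uD.
by apply: minC => //; apply: subset_trans sBC.
Qed.

Section Restriction.
Variables (M : matroid T) (C : {set T}).
Local Notation S := {x : T | x \in C}.

Definition restr_indep : {set {set S}} :=
  [set I : {set S} | val @: I \in indep M].

Fact restr_indep0 : set0 \in restr_indep.
Proof. by rewrite inE imset0 indep0. Qed.

Fact restr_indepS (I J : {set S}) :
  I \subset J -> J \in restr_indep -> I \in restr_indep.
Proof. by rewrite !inE => sIJ; apply: indepS; apply: imsetS. Qed.

Fact restr_indep_aug (I J : {set S}) :
  I \in restr_indep -> J \in restr_indep -> #|I| < #|J| ->
  exists2 x, x \in J :\: I & x |: I \in restr_indep.
Proof.
rewrite !inE => indI indJ ltIJ.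
have [|x] := indep_aug indI indJ; first by rewrite !card_imset //; apply: val_inj.
rewrite inE => /andP[xI /imsetP[y Jy xy]]; subst x => indyI.
exists y; rewrite !inE ?Jy ?andbT.
  by apply: contra xI => Iy; apply: imset_f.
by rewrite imsetU imset_set1.
Qed.

Definition restrict : matroid S :=
  Matroid restr_indep0 restr_indepS restr_indep_aug.

End Restriction.

(* U_{2,m} with m >= 3. *)
Definition single_line M : bool :=
  (2 < #|T|) && (indep M == [set A : {set T} | #|A| <= 2]).

(* [ordS] is the cyclic successor.  The condition 2 < n only excludes the
   degenerate cases: two lines of a simple matroid of rank at most three share
   at most one point. *)
Definition is_cycle M : Prop :=
  exists (n : nat) (l : 'I_n -> {set T}) (p : 'I_n -> T),
    [/\ 2 < n,
        injective l,
        lines M = [set l i | i : 'I_n],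
        forall i, lines_at M (p i) = [set l i; l (ordS i)] &
        forall x, x \notin codom p -> degree M x = 1].

Definition collinear M : rel T :=
  [rel x y | [exists L in lines M, (x \in L) && (y \in L)]].

(* [collinear M] is symmetric, so its reflexive transitive closure is the
   equivalence relation it generates. *)
Definition component M (x : T) : {set T} :=
  [set y | connect (collinear M) x y].

End Matroids.

(* K is the free gluing of M and N along p and q, up to the labelling of its
   points: f and g exhibit the ground set of K as the disjoint union of T1 and
   T2 with p and q identified.  This determines K up to isomorphism, since a
   point-line configuration is determined by its lines. *)
Definition free_gluing (T1 T2 T : finType) (M : matroid T1) (N : matroid T2)
    (p : T1) (q : T2) (K : matroid T) : Prop :=
  point_line_config K /\
  exists (f : T1 -> T) (g : T2 -> T),
    [/\ injective f /\ injective g,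
        forall x y, f x = g y <-> x = p /\ y = q,
        forall z, z \in codom f \/ z \in codom g &
        lines K = ([set f @: (L : {set T1}) | L in lines M] :|:
                   [set g @: (L : {set T2}) | L in lines N])%SET].

Definition line_or_cycle (T : finType) (M : matroid T) : Prop :=
  point_line_config M /\ (single_line M \/ is_cycle M).

Inductive connected_cactus : forall T : finType, matroid T -> Prop :=
| Cactus_base (T : finType) (M : matroid T) :
    line_or_cycle M -> connected_cactus M
| Cactus_glue (T1 T2 T : finType) (M : matroid T1) (N : matroid T2)
    (p : T1) (q : T2) (K : matroid T) :
    connected_cactus M -> line_or_cycle N -> free_gluing M N p q K ->
    connected_cactus K.

Definition cactus (T : finType) (M : matroid T) : Prop :=
  point_line_config M /\
  forall x : T, connected_cactus (restrict M (component M x)).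

(* Imported only here: classical_sets shadows finset names such as set0. *)
From mathcomp Require Import boolp classical_sets functions cardinality reals.
From mathcomp Require Import complex mpoly.

Section Varieties.
Local Open Scope ring_scope.
Local Open Scope classical_set_scope.

Variables (F : fieldType) (d : nat).

(* A point of (F^3)^d is the d x 3 matrix g whose i-th row is gamma_i.
   Dependence is that of the indexed family, so repeated vectors count. *)
Definition lin_dependent (g : 'M[F]_(d, 3)) (A : {set 'I_d}) : bool :=
  ~~ free [seq row i g | i in A].

Definition Gamma (N : matroid 'I_d) : set 'M[F]_(d, 3) :=
  [set g | forall A : {set 'I_d}, dependent N A <-> lin_dependent g A].

Definition circuit_variety (N : matroid 'I_d) : set 'M[F]_(d, 3) :=
  [set g | forall A : {set 'I_d}, dependent N A -> lin_dependent g A].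

(* The 3d coordinates of a point are read off through [mxvec]. *)
Definition zero_locus (S : set {mpoly F[d * 3]}) : set 'M[F]_(d, 3) :=
  [set g | forall P, S P -> P.@[mxvec g 0] = 0].

Definition zariski_closed (X : set 'M[F]_(d, 3)) : Prop :=
  exists S, X = zero_locus S.

Definition zariski_closure (X : set 'M[F]_(d, 3)) : set 'M[F]_(d, 3) :=
  smallest zariski_closed X.

Definition matroid_variety (N : matroid 'I_d) : set 'M[F]_(d, 3) :=
  zariski_closure (Gamma N).

Definition irreducible_set (X : set 'M[F]_(d, 3)) : Prop :=
  X !=set0 /\
  forall Y Z, zariski_closed Y -> zariski_closed Z ->
    X `<=` Y `|` Z -> X `<=` Y \/ X `<=` Z.

Definition irreducible_components (V : set 'M[F]_(d, 3)) :
    set (set 'M[F]_(d, 3)) :=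
  [set X | [/\ irreducible_set X, X `<=` V &
     forall Y, irreducible_set Y -> X `<=` Y -> Y `<=` V -> Y = X]].

End Varieties.

Arguments Gamma F {d} N.
Arguments circuit_variety F {d} N.
Arguments matroid_variety F {d} N.

(* Main.v *)
Require Import Defs.
From mathcomp Require Import all_boot all_order all_algebra ring zify.
From mathcomp Require Import boolp.

(* A point gamma of the circuit variety of a cactus M is completed by a normal
   vector for a plane through each line.  This turns it into a family of
   vectors of F^3 on the Levi graph of M (points against lines), orthogonal
   along edges; a loop is a zero vector.  For a fixed set J of loops the
   families that vanish exactly on J form an irreducible set: the Levi graph is
   built by adding vertices which either have at most one earlier neighbour p,
   so that the new vector is v_p x u with u free, or close a cycle between v_0
   and v_2, so that it is a multiple of v_0 x v_2 when these are not parallel.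
   Nonparallel position is dense, because next to v_2 the cycle contains three
   vertices of degree two whose vectors can be moved (this uses that cycles of
   a Levi graph have length at least six).

   A colouring of the points by the basis vectors which leaves out a colour on
   every line exhibits any given independent set as independent in some such
   family, so by irreducibility Gamma(M(J)) is dense in the families of J.
   Finally a zero vector at a point of degree at most two moves into the
   intersection of its planes, so the J inside Q_M suffice. *)

Set Implicit Arguments.
Unset Strict Implicit.
Unset Printing Implicit Defensive.

Import Order.TTheory GRing.Theory Num.Theory.

Local Open Scope ring_scope.

(** * Vectors in three-space *)

Section Cross.
Variable R : comNzRingType.
Implicit Types u w : 'rV[R]_3.

(** In the coordinates of the points alone, the plane of a line is lost as soon as its points become
    parallel. A recorded normal stays nonzero even when all points of the line vanish, and it makes
    the condition on each new vector linear, so that fibres have polynomial parametrizations. The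
    obstacle is the closing vertex [x]: its solution space jumps where [v_0] and [v_2] are parallel,
    which could create a further component. In a cycle of length four it does: when [v_0] and [v_2]
    are both orthogonal to [x] and to [v_3], either [x] is parallel to [v_3] or [v_0] is parallel to
    [v_2], and these loci have the same dimension. From length six on, the vectors in between leave
    room to undo the parallelism. Density is tested along explicit polynomial curves, so each
    density claim reduces to a nonzero polynomial having a nonroot. *)

Definition dot u w : R := u 0 0 * w 0 0 + u 0 1 * w 0 1 + u 0 2 * w 0 2.

Definition row3 (a b c : R) : 'rV[R]_3 := \row_i [:: a; b; c]`_i.

Definition cross u w : 'rV[R]_3 :=
  row3 (u 0 1 * w 0 2 - u 0 2 * w 0 1) (u 0 2 * w 0 0 - u 0 0 * w 0 2)
       (u 0 0 * w 0 1 - u 0 1 * w 0 0).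

Lemma row3E a b c :
  (row3 a b c 0 0 = a) * (row3 a b c 0 1 = b) * (row3 a b c 0 2 = c).
Proof. by rewrite !mxE. Qed.

Lemma row3P u w :
  u 0 0 = w 0 0 -> u 0 1 = w 0 1 -> u 0 2 = w 0 2 -> u = w.
Proof.
move=> h0 h1 h2; apply/rowP => -[[|[|[|//]]] lti].
- by rewrite (_ : Ordinal lti = 0) //; apply/val_inj.
- by rewrite (_ : Ordinal lti = 1) //; apply/val_inj.
- by rewrite (_ : Ordinal lti = 2) //; apply/val_inj.
Qed.

Definition coordE := (row3E, mxE).

Lemma dotC u w : dot u w = dot w u.
Proof. by rewrite /dot; ring. Qed.

Lemma dot0l u : dot 0 u = 0.
Proof. by rewrite /dot !mxE; ring. Qed.

Lemma dot0r u : dot u 0 = 0.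
Proof. by rewrite dotC dot0l. Qed.

Lemma dotDr u w z : dot u (w + z) = dot u w + dot u z.
Proof. by rewrite /dot !mxE; ring. Qed.

Lemma dotZr a u w : dot u (a *: w) = a * dot u w.
Proof. by rewrite /dot !mxE; ring. Qed.

Lemma dotZl a u w : dot (a *: u) w = a * dot u w.
Proof. by rewrite dotC dotZr dotC. Qed.

Lemma crossC u w : cross u w = - cross w u.
Proof. by apply: row3P; rewrite !coordE; ring. Qed.

Lemma crossDr u w z : cross u (w + z) = cross u w + cross u z.
Proof. by apply: row3P; rewrite !coordE; ring. Qed.

Lemma crossZr a u w : cross u (a *: w) = a *: cross u w.
Proof. by apply: row3P; rewrite !coordE; ring. Qed.

Lemma cross0r u : cross u 0 = 0.
Proof. by apply: row3P; rewrite !coordE; ring. Qed.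

Lemma dot_crossl u w : dot u (cross u w) = 0.
Proof. by rewrite /dot !coordE; ring. Qed.

Lemma dot_crossr u w : dot w (cross u w) = 0.
Proof. by rewrite /dot !coordE; ring. Qed.

Lemma dot_cross_rot u w z : dot (cross u w) z = dot (cross z u) w.
Proof. by rewrite /dot !coordE; ring. Qed.

Lemma double_cross u w z : cross u (cross w z) = dot u z *: w - dot u w *: z.
Proof. by apply: row3P; rewrite !coordE /dot; ring. Qed.

End Cross.

Lemma map_cross (R S : comNzRingType) (h : {rmorphism R -> S}) u w :
  map_mx h (cross u w) = cross (map_mx h u) (map_mx h w).
Proof. by apply: row3P; rewrite !coordE !(rmorphB h) !(rmorphM h). Qed.

Section CrossField.
Variable F : fieldType.
Implicit Types u w : 'rV[F]_3.

Lemma row3_neq0 u : u != 0 -> exists i, u 0 i != 0.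
Proof.
move=> u0; apply/existsP; apply: contraNT u0 => /existsPn u0.
by apply/eqP/rowP => i; rewrite mxE; apply/eqP; rewrite -[_ == _]negbK u0.
Qed.

(** The form [dot] is bilinear, so [dot u u] may vanish for nonzero [u]; pairing with a basis vector
    reads off a nonzero coordinate instead. *)
Lemma dot_neq0 u : u != 0 -> exists w, dot u w != 0.
Proof.
move=> /row3_neq0 [i ui0]; exists (delta_mx 0 i).
suff -> : dot u (delta_mx 0 i) = u 0 i by [].
case: i {ui0} => -[|[|[|//]]] lti.
- by rewrite (_ : Ordinal lti = 0) ?/dot ?mxE /=; [ring | apply/val_inj].
- by rewrite (_ : Ordinal lti = 1) ?/dot ?mxE /=; [ring | apply/val_inj].
- by rewrite (_ : Ordinal lti = 2) ?/dot ?mxE /=; [ring | apply/val_inj].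
Qed.

(** When [dot u w = 0], [double_cross] reduces [cross u (cross w z)] to [dot u z *: w], and [z] is
    chosen to make the scalar invertible. *)
Lemma orthP u w : u != 0 -> dot u w = 0 -> exists z, w = cross u z.
Proof.
move=> /dot_neq0[z uz] uw; exists ((dot u z)^-1 *: cross w z).
rewrite crossZr double_cross uw scale0r subr0 scalerA mulVf // scale1r //.
Qed.

(** Both orthogonality hypotheses make [cross (cross u w) a] vanish; crossing it with [z] and
    expanding by [double_cross] shows that [a] is a multiple. *)
Lemma orth2P u w a : cross u w != 0 -> dot u a = 0 -> dot w a = 0 ->
  exists s, a = s *: cross u w.
Proof.
move=> /dot_neq0[z nz] ua wa.
exists ((dot (cross u w) z)^-1 * dot a z).
have E : dot (cross u w) z *: a = dot a z *: cross u w.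
  have := double_cross z (cross u w) a.
  rewrite (crossC (cross u w)) double_cross (dotC a u) (dotC a w) ua wa.
  rewrite !scale0r subr0 oppr0 cross0r => /esym/eqP.
  by rewrite subr_eq0 => /eqP; rewrite !(dotC z).
by rewrite -scalerA -E scalerA mulVf // scale1r.
Qed.

Lemma crossP u w : u != 0 -> cross u w = 0 -> exists s, w = s *: u.
Proof.
move=> /dot_neq0[z uz] uw; exists ((dot u z)^-1 * dot w z).
have := double_cross z u w; rewrite uw cross0r => /esym/eqP.
rewrite subr_eq0 => /eqP; rewrite !(dotC z) => E.
by rewrite -scalerA E scalerA mulVf // scale1r.
Qed.

Lemma ex_orth u : exists2 w, w != 0 & dot u w = 0.
Proof.
have [-> | u0] := eqVneq u 0.
  exists (row3 1 0 0); last by rewrite dot0l.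
  by apply/eqP => /rowP/(_ 0)/eqP; rewrite !coordE oner_eq0.
have [w uw] := dot_neq0 u0.
have [z1|] := eqVneq (cross u (row3 1 0 0)) 0; last first.
  by exists (cross u (row3 1 0 0)) => //; rewrite dot_crossl.
exists (cross u (row3 0 1 0)); last by rewrite dot_crossl.
apply: contra_neq u0 => z2.
move: z1 z2 => /rowP z1 /rowP z2.
move: (z1 1) (z1 2) (z2 0) (z2 2); rewrite !coordE !(mulr1, mulr0, subr0, sub0r).
by move=> h1 /eqP; rewrite oppr_eq0 => /eqP h2 _ h4; apply: row3P; rewrite !mxE.
Qed.

Lemma ex_orth2 u w : exists2 z, z != 0 & dot u z = 0 /\ dot w z = 0.
Proof.
have [uw0|uw] := eqVneq (cross u w) 0; last first.
  by exists (cross u w); rewrite ?dot_crossl ?dot_crossr.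
have [->|u0] := eqVneq u 0.
  by have [z z0 wz] := ex_orth w; exists z; rewrite // dot0l.
have [s ->] := crossP u0 uw0; have [z z0 uz] := ex_orth u.
by exists z; rewrite // dotZl uz mulr0.
Qed.

End CrossField.

(** * Polynomial curves and irreducibility *)

Section Curves.
Variable F : numFieldType.

(** Nonvanishing of a polynomial replaces cofiniteness: conjunctions become products, and the
    polynomial is usually the value of a function along a curve. *)
Definition generic (P : F -> Prop) : Prop :=
  exists2 h : {poly F}, h != 0 & forall t, h.[t] != 0 -> P t.

Lemma poly_nonroot (h : {poly F}) : h != 0 -> exists t, h.[t] != 0.
Proof.
(* In characteristic zero the naturals below [size h] are distinct, and they outnumber the possible
   roots. *)
move=> h0; pose s : seq F := [seq i%:R | i <- iota 0 (size h)].
have us : uniq s by rewrite map_inj_uniq ?iota_uniq // => i j /eqP; rewrite eqr_nat => /eqP.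
apply/not_existsP => root_h.
have rs : all (root h) s.
  by apply/allP => t _; apply/eqP/eqP; rewrite -[_ == _]negbK; apply/negP/root_h.
by have := max_poly_roots h0 rs us; rewrite size_map size_iota ltnn.
Qed.

Lemma generic_ex P : generic P -> exists t, P t.
Proof. by case=> h /poly_nonroot[t ht] hP; exists t; apply: hP. Qed.

Lemma genericW (P Q : F -> Prop) : (forall t, P t -> Q t) -> generic P -> generic Q.
Proof. by move=> PQ [h h0 hP]; exists h => // t /hP/PQ. Qed.

Lemma generic_all (P : F -> Prop) : (forall t, P t) -> generic P.
Proof. by move=> allP; exists 1; rewrite ?oner_eq0. Qed.

Lemma generic_and P Q : generic P -> generic Q -> generic (fun t => P t /\ Q t).
Proof.
move=> [h h0 hP] [k k0 kQ]; exists (h * k); first by rewrite mulf_neq0.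
by move=> t; rewrite hornerM mulf_eq0 negb_or => /andP[/hP ? /kQ].
Qed.

Lemma generic_poly (h : {poly F}) t : h.[t] != 0 -> generic (fun t => h.[t] != 0).
Proof. by move=> ht; exists h => //; apply: contraNneq ht => ->; rewrite horner0. Qed.

Definition evv (t : F) (u : 'rV[{poly F}]_3) : 'rV[F]_3 := map_mx (horner_eval t) u.

Definition cstv (a : 'rV[F]_3) : 'rV[{poly F}]_3 := map_mx polyC a.

Definition linev (a z : 'rV[F]_3) : 'rV[{poly F}]_3 := cstv a + 'X *: cstv z.

Lemma evv_cst t a : evv t (cstv a) = a.
Proof. by apply/rowP => i; rewrite !mxE /horner_eval hornerC. Qed.

Lemma evvZ t q u : evv t (q *: u) = q.[t] *: evv t u.
Proof. by apply/rowP => i; rewrite !mxE /horner_eval hornerM. Qed.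

Lemma evv_line t a z : evv t (linev a z) = a + t *: z.
Proof.
by apply/rowP => i; rewrite !mxE /horner_eval hornerD hornerM hornerX !hornerC.
Qed.

Lemma evv_cross t u w : evv t (cross u w) = cross (evv t u) (evv t w).
Proof. exact: (map_cross (horner_eval t)). Qed.

Definition evE := (evv_cst, evvZ, evv_line, evv_cross, hornerC).

Lemma generic_vec t u : evv t u != 0 -> generic (fun t => evv t u != 0).
Proof.
move=> /row3_neq0[i]; rewrite mxE => /generic_poly.
by apply: genericW => t'; apply: contraNneq => /rowP/(_ i)/eqP; rewrite !mxE.
Qed.

Variable V : finType.

Notation conf := (V -> 'rV[F]_3).
Notation curve := (V -> 'rV[{poly F}]_3).

Definition evc (t : F) (c : curve) : conf := fun x => evv t (c x).

(* A stand-in for polynomial functions that composes with the constructions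
   below without any bookkeeping of coordinates. *)
Definition regular (f : conf -> F) : Prop :=
  forall c : curve, exists q : {poly F}, forall t, f (evc t c) = q.[t].

Lemma regular_mul f g : regular f -> regular g -> regular (fun v => f v * g v).
Proof.
move=> rf rg c; have [q fq] := rf c; have [r gr] := rg c.
by exists (q * r) => t; rewrite hornerM fq gr.
Qed.

Lemma regular_cst a : regular (fun=> a).
Proof. by move=> c; exists a%:P => t; rewrite hornerC. Qed.

(** Irreducibility for the topology whose basic open sets are the nonvanishing loci of regular
    functions. The empty set qualifies, so the existence of realizations is a separate matter. *)
Definition irr (S : conf -> Prop) : Prop :=
  forall f g a b, regular f -> regular g -> S a -> S b -> f a != 0 -> g b != 0 ->
    exists c, [/\ S c, f c != 0 & g c != 0].

Definition adh (S : conf -> Prop) (a : conf) : Prop :=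
  forall f, regular f -> f a != 0 -> exists2 b, S b & f b != 0.

Lemma adh_id (S : conf -> Prop) a : S a -> adh S a.
Proof. by move=> Sa f _ fa; exists a. Qed.

Lemma adhW (S S' : conf -> Prop) a : (forall v, S v -> S' v) -> adh S a -> adh S' a.
Proof. by move=> SS' Sa f rf /(Sa f rf)[b /SS']; exists b. Qed.

(** Along [c] a regular function is a polynomial in the parameter; nonzero at [t0], it is nonzero
    generically. Asking only for [adh S] on the curve allows deformations to be chained. *)
Lemma adh_curve S a (c : curve) t0 : evc t0 c = a ->
  generic (fun t => adh S (evc t c)) -> adh S a.
Proof.
move=> ca gS f rf fa; have [q fq] := rf c.
have gq : generic (fun t => q.[t] != 0) by apply: (@generic_poly _ t0); rewrite -fq ca.
have [t [aS qt]] := generic_ex (generic_and gS gq).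
by have [|b] := aS f rf; [rewrite fq | exists b].
Qed.

Lemma irr_all : irr (fun=> True).
Proof.
move=> f g a b rf rg _ _ fa gb; pose c x := linev (a x) (b x - a x).
have [q fq] := rf c; have [r gr] := rg c.
have c0 : evc 0 c = a by apply/funext => x; rewrite /evc evE scale0r addr0.
have c1 : evc 1 c = b by apply/funext => x; rewrite /evc evE scale1r addrC subrK.
have gq : generic (fun t => q.[t] != 0) by apply: (@generic_poly _ 0); rewrite -fq c0.
have gg : generic (fun t => r.[t] != 0) by apply: (@generic_poly _ 1); rewrite -gr c1.
have [t [qt rt]] := generic_ex (generic_and gq gg).
by exists (evc t c); rewrite fq gr.
Qed.

Definition upd (T : Type) (v : V -> T) x w : V -> T := fun y => if y == x then w else v y.

Lemma upd_id (T : Type) (v : V -> T) x : upd v x (v x) = v.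
Proof. by apply/funext => y; rewrite /upd; case: eqP => // ->. Qed.

Lemma evc_upd t (c : curve) x w : evc t (upd c x w) = upd (evc t c) x (evv t w).
Proof. by apply/funext => y; rewrite /evc /upd; case: eqP. Qed.

Lemma evc_cst t (a : conf) : evc t (fun x => cstv (a x)) = a.
Proof. by apply/funext => x; rewrite /evc evE. Qed.

Definition polymap (phi : conf -> 'rV[F]_3 -> 'rV[F]_3) : Prop :=
  forall (c : curve) u, exists w, forall t, phi (evc t c) (evv t u) = evv t w.

(** With the parameters [u1] and [u2] of two points frozen, irreducibility of [S] yields a common
    base [c]; in the fibre over [c] the two values of [phi] are then joined by the segment from [u1]
    to [u2]. *)
Lemma irr_extend (S S' : conf -> Prop) x (inJ : bool) phi :
  irr S -> polymap phi ->
  (forall a, S' a -> S a) ->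
  (forall a, S' a -> adh (fun a => S' a /\ exists u, a x = phi a u) a) ->
  (forall c u, S c -> (~~ inJ -> phi c u != 0) -> S' (upd c x (phi c u))) ->
  (forall a, S' a -> ~~ inJ -> a x != 0) ->
  irr S'.
Proof.
move=> irrS pphi sS'S dens ext nz f g a b rf rg S'a S'b fa gb.
have [{S'a fa}a [S'a [u1 au]] fa] := dens a S'a f rf fa.
have [{S'b gb}b [S'b [u2 bu]] gb] := dens b S'b g rg gb.
have reg h u : regular h -> regular (fun v => h (upd v x (phi v u))).
  move=> rh c; have [w cw] := pphi c (cstv u).
  have [q hq] := rh (upd c x w); exists q => t.
  by rewrite -hq evc_upd -cw evE.
(* The factor [k] keeps the new vector nonzero over the common base at the parameter [u1]; along the
   segment it is then nonzero generically. *)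
have [k [rk ka kgood]] : exists k, [/\ regular k, k a != 0 &
    forall v, k v != 0 -> ~~ inJ -> phi v u1 != 0].
  case: (boolP inJ) => [J | nJ].
    by exists (fun=> 1); rewrite oner_eq0; split=> //; apply: regular_cst.
  have := nz a S'a nJ; rewrite au => /row3_neq0[i phi0].
  exists (fun v => phi v u1 0 i); split=> //.
    move=> c; have [w cw] := pphi c (cstv u1); exists (w 0 i) => t.
    by have := cw t; rewrite evE => ->; rewrite mxE.
  by move=> v vi _; apply: contraNneq vi => ->; rewrite mxE.
have [||||||c [Sc]] := irrS (fun v => f (upd v x (phi v u1)) * k v)
    (fun v => g (upd v x (phi v u2))) a b.
- exact: regular_mul (reg _ _ rf) rk.
- exact: reg.
- exact: sS'S.
- exact: sS'S.
- by rewrite mulf_neq0 // -au upd_id.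
- by rewrite -bu upd_id.
rewrite mulf_eq0 negb_or => /andP[fc kc] gc.
have [W cW] := pphi (fun x => cstv (c x)) (linev u1 (u2 - u1)).
pose C := upd (fun x => cstv (c x)) x W.
have {}cW t : phi c (u1 + t *: (u2 - u1)) = evv t W by rewrite -cW evE evc_cst.
have CE t : evc t C = upd c x (phi c (u1 + t *: (u2 - u1))).
  by rewrite evc_upd evc_cst cW.
have [q fq] := rf C; have [r gr] := rg C.
have gq : generic (fun t => q.[t] != 0).
  by apply: (@generic_poly _ 0); rewrite -fq CE scale0r addr0.
have gg : generic (fun t => r.[t] != 0).
  by apply: (@generic_poly _ 1); rewrite -gr CE scale1r addrC subrK.
have gk : generic (fun t => ~~ inJ -> phi c (u1 + t *: (u2 - u1)) != 0).
  case: (boolP inJ) => [J | nJ]; first exact: generic_all.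
  have W0 : evv 0 W != 0 by rewrite -cW scale0r addr0 kgood.
  by apply: genericW (generic_vec W0) => t; rewrite cW.
have [t [[qt rt] kt]] := generic_ex (generic_and (generic_and gq gg) gk).
exists (evc t C); split; rewrite ?fq ?gr // CE.
exact: ext.
Qed.

End Curves.

(** * Orthogonal realizations of graphs *)

Lemma generic_finall (F : numFieldType) (I : finType) (P : I -> F -> Prop) :
  (forall i, generic (P i)) -> generic (fun t => forall i, P i t).
Proof.
move=> gP; have /choice[h hP] : forall i, exists h : {poly F},
    h != 0 /\ forall t, h.[t] != 0 -> P i t by move=> i; have [h] := gP i; exists h.
exists (\prod_i h i); first by apply/prodf_neq0 => i _; have [] := hP i.
move=> t; rewrite horner_prod => /prodf_neq0 ht i.
by have [_] := hP i; apply; apply: ht.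
Qed.

Section GraphRealizations.
Variables (F : numFieldType) (V : finType) (e : rel V) (J : {set V}).
Hypotheses (esym : symmetric e) (eirr : irreflexive e).
Implicit Types (D : {set V}) (x y z : V) (a b v : V -> 'rV[F]_3).

(* Vectors at vertices outside D are unconstrained. *)
Definition realization D v : Prop :=
  (forall x, x \in D -> (v x == 0) = (x \in J)) /\
  (forall x y, x \in D -> y \in D -> e x y -> dot (v x) (v y) = 0).

Lemma realizationS D D' v : D \subset D' -> realization D' v -> realization D v.
Proof.
move=> /subsetP sDD' [nz orth]; split=> [x /sDD'/nz // | x y /sDD' xD /sDD' yD].
exact: orth.
Qed.

Lemma realization_upd D v x w : realization D v -> x \notin D ->
  (w == 0) = (x \in J) -> (forall y, y \in D -> e x y -> dot w (v y) = 0) ->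
  realization (x |: D) (upd v x w).
Proof.
move=> [nz orth] xD w0 ow.
have neq y : y \in D -> (y == x) = false by apply: contraTF => /eqP->.
split=> [y | y z]; rewrite !in_setU1 /upd.
  by case/predU1P => [-> | yD]; rewrite ?eqxx ?neq ?nz.
case/predU1P => [-> | yD]; case/predU1P => [-> | zD]; rewrite ?eqxx ?neq ?eirr //.
- exact: ow.
- by rewrite dotC esym; apply: ow.
- exact: orth.
Qed.

(** Neighbours in [J] carry the zero vector and impose nothing, so the new vector is free, or zero
    at a loop. *)
Lemma irr_leaf0 D x : irr (realization D) -> x \notin D ->
  (forall y, y \in D -> e x y -> y \in J) -> irr (realization (x |: D)).
Proof.
move=> irrD xD xJ; pose phi (_ : V -> 'rV[F]_3) u := if x \in J then 0 else u : 'rV[F]_3.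
apply: (@irr_extend _ _ _ _ x (x \in J) phi irrD).
- move=> c u; exists (if x \in J then 0 else u) => t; rewrite /phi.
  by case: ifP => // _; apply/rowP => i; rewrite !mxE /horner_eval horner0.
- by move=> a; apply: realizationS; apply: subsetUr.
- move=> a Xa; apply: adh_id; split=> //; exists (a x).
  by rewrite /phi; case: ifP => // Jx; apply/eqP; case: Xa => ->; rewrite // setU11.
- move=> c u Xc nz; apply: realization_upd => //.
    by move: nz; rewrite /phi; case: ifP => [_|_ /(_ isT)/negPf//]; rewrite eqxx.
  move=> y yD exy; have /eqP-> : c y == 0 by case: (Xc) => -> // _; apply: (xJ y).
  by rewrite dot0r.
- by move=> a [nz _]; rewrite nz // setU11.
Qed.

Lemma irr_leaf1 D x p : irr (realization D) -> x \notin D ->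
  p \in D -> p \notin J -> e x p ->
  (forall y, y \in D -> e x y -> y = p \/ y \in J) -> irr (realization (x |: D)).
Proof.
move=> irrD xD pD pJ exp xJ.
pose phi (v : V -> 'rV[F]_3) u := if x \in J then 0 else cross (v p) u.
apply: (@irr_extend _ _ _ _ x (x \in J) phi irrD).
- move=> c u; exists (if x \in J then 0 else cross (c p) u) => t; rewrite /phi.
  case: ifP => _; last by rewrite evE.
  by apply/rowP => i; rewrite !mxE /horner_eval horner0.
- by move=> a; apply: realizationS; apply: subsetUr.
- move=> a Xa; apply: adh_id; split=> //; rewrite /phi.
  have [Jx | Jx] := boolP (x \in J).
    by exists 0; apply/eqP; case: Xa => ->; rewrite // setU11.
  case: Xa => nz orth; apply: orthP; first by rewrite nz // in_setU1 pD orbT.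
  by apply: orth; rewrite ?in_setU1 ?eqxx ?pD ?orbT // esym.
- move=> c u Xc nz; apply: realization_upd => //.
    by move: nz; rewrite /phi; case: ifP => [_|_ /(_ isT)/negPf//]; rewrite eqxx.
  move=> y yD /(xJ y yD)[-> | yJ].
    by rewrite /phi; case: ifP => _; rewrite ?dot0l // dotC dot_crossl.
  by have /eqP-> : c y == 0 by [case: (Xc) => ->]; rewrite dot0r.
- by move=> a [nz _]; rewrite nz // setU11.
Qed.

(** The vertices of [s] move along [c] and all others stay put. Orthogonality at [s] is required for
    every parameter, whereas nonvanishing holds at [t0] and hence generically, so the curve
    generically consists of realizations. *)
Lemma adh_move D (S : (V -> 'rV[F]_3) -> Prop) a (c : V -> 'rV[{poly F}]_3)
    (s : seq V) t0 : realization D a -> evc t0 c = a ->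
  (forall y, y \notin s -> c y = cstv (a y)) ->
  (forall y, y \in s -> y \notin J) ->
  (forall y z, y \in s -> z \in D -> e y z ->
     forall t, dot (evv t (c y)) (evv t (c z)) = 0) ->
  generic (fun t => realization D (evc t c) -> adh S (evc t c)) -> adh S a.
Proof.
move=> [nz orth] ca cE sJ sorth gS; apply: (adh_curve ca).
have gX : generic (fun t => realization D (evc t c)).
  have : generic (fun t => forall y, y \in D -> (evc t c y == 0) = (y \in J)).
    apply: generic_finall => y; have [yD | _] := boolP (y \in D); last exact: generic_all.
    have [yJ | yJ] := boolP (y \in J).
      apply: generic_all => t _; rewrite /evc cE ?evE ?nz //.
      by apply: contraL yJ => /sJ.
    have /generic_vec : evv t0 (c y) != 0 by rewrite -/(evc t0 c y) ca nz.
    by apply: genericW => t /negPf.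
  apply: genericW => t nzt; split=> // y z yD zD eyz; rewrite /evc.
  have [ys | ys] := boolP (y \in s); first exact: sorth.
  have [zs | zs] := boolP (z \in s); first by rewrite dotC sorth // esym.
  by rewrite !cE // !evE orth.
by apply: genericW (generic_and gX gS) => t [Xt /(_ Xt)].
Qed.

(** * Density of nonparallel position at a closing vertex *)

Section Closing.
Variables (D : {set V}) (x v0 v2 v3 v4 v5 : V).
Hypothesis uniq6 : uniq [:: x; v0; v2; v3; v4; v5].
Hypothesis subD : {subset [:: x; v0; v2; v3; v4; v5] <= D}.
Hypotheses (e0 : e x v0) (e2 : e x v2) (e23 : e v2 v3) (e34 : e v3 v4) (e45 : e v4 v5).
Hypothesis nbr2 : forall y, y \in D -> e v2 y -> y = x \/ y = v3.
Hypothesis nbr3 : forall y, y \in D -> e v3 y -> y = v2 \/ y = v4.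
Hypothesis nbr4 : forall y, y \in D -> e v4 y -> y = v3 \/ y = v5.
Hypotheses (xJ : x \notin J) (v0J : v0 \notin J) (v2J : v2 \notin J).

Let good a := realization D a /\ cross (a v0) (a v2) != 0.

Let xD : x \in D. Proof. by apply: subD; rewrite !inE eqxx. Qed.
Let v0D : v0 \in D. Proof. by apply: subD; rewrite !inE eqxx ?orbT. Qed.
Let v2D : v2 \in D. Proof. by apply: subD; rewrite !inE eqxx ?orbT. Qed.
Let v3D : v3 \in D. Proof. by apply: subD; rewrite !inE eqxx ?orbT. Qed.
Let v4D : v4 \in D. Proof. by apply: subD; rewrite !inE eqxx ?orbT. Qed.
Let v5D : v5 \in D. Proof. by apply: subD; rewrite !inE eqxx ?orbT. Qed.

Let neqs : ((x == v2) = false) * ((x == v3) = false) * ((x == v4) = false) *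
  ((v0 == v2) = false) * ((v0 == v3) = false) * ((v0 == v4) = false) *
  ((v5 == v2) = false) * ((v5 == v3) = false) * ((v5 == v4) = false) *
  ((v2 == v3) = false) * ((v2 == v4) = false) * ((v3 == v4) = false) *
  ((v3 == v2) = false) * ((v4 == v2) = false) * ((v4 == v3) = false).
Proof.
move: uniq6; rewrite /= !inE !negb_or -!andbA.
move=> /and5P[h1 h2 h3 h4 /and5P[h5 h6 h7 h8 /and5P[h9 h10 h11 h12 /and4P[h13 h14 h15 _]]]].
rewrite !(eq_sym v5) !(eq_sym v4 v2) !(eq_sym v4 v3) !(eq_sym v3 v2).
by do ![split]; apply: negbTE.
Qed.

Let orth_in a y z : realization D a -> y \in D -> z \in D -> e y z -> dot (a y) (a z) = 0.
Proof. by case=> _; apply. Qed.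

Let nz_in a y : realization D a -> y \in D -> y \notin J -> a y != 0.
Proof. by case=> nz _ yD; rewrite nz. Qed.

(* The edge (v2, v3) imposes nothing beyond (x, v2): turn v2 in the plane
   orthogonal to x. *)
Let turn_v2 a : realization D a -> cross (a x) (a v3) = 0 -> adh good a.
Proof.
move=> Xa par; have [bad | gd] := eqVneq (cross (a v0) (a v2)) 0; last exact: adh_id.
have x0 := nz_in Xa xD xJ; have [s v3E] := crossP x0 par.
have [w v0w] := dot_neq0 (nz_in Xa v0D v0J).
(* This [z] lies in the plane orthogonal to the vector at [x], and [double_cross] turns
   [cross (a v0) z] into [dot (a v0) w *: a x], which is nonzero. *)
pose z := cross (a x) w.
pose c := upd (fun y => cstv (a y)) v2 (linev (a v2) z).
have cE y : c y = if y == v2 then linev (a v2) z else cstv (a y) by [].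
apply: (@adh_move D good a c [:: v2] 0) => //.
- by rewrite evc_upd evc_cst evE scale0r addr0 upd_id.
- by move=> y; rewrite inE => /negPf; rewrite cE => ->.
- by move=> y; rewrite inE => /eqP->.
- have ox t : dot (a v2 + t *: z) (a x) = 0.
    by rewrite dotC dotDr dotZr dot_crossl (orth_in Xa) // mulr0 addr0.
  move=> y u; rewrite inE => /eqP-> uD /(nbr2 uD)[->|->] t; rewrite !cE eqxx neqs !evE //.
  by rewrite v3E dotZr ox mulr0.
have : evv 1 (cross (cstv (a v0)) (c v2)) != 0.
  rewrite cE eqxx !evE scale1r crossDr bad add0r double_cross.
  rewrite [dot _ (a x)]dotC (orth_in Xa) // scale0r subr0 scaler_eq0 negb_or.
  by rewrite v0w.
move=> /generic_vec; apply: genericW => t; rewrite evv_cross evE => gt Xt.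
by apply: adh_id; split=> //; rewrite /evc cE neqs evE.
Qed.

(* The condition on v4 lets v3 leave the plane orthogonal to v0. *)
Let turn_v3 a : realization D a -> cross (a x) (a v3) != 0 ->
  a v4 = 0 \/ cross (a v0) (a v4) != 0 -> adh good a.
Proof.
move=> Xa npar hv4; have [bad | gd] := eqVneq (cross (a v0) (a v2)) 0; last exact: adh_id.
have v00 := nz_in Xa v0D v0J.
(* Adding multiples of [z] to the vector at [v3] preserves orthogonality to [v4] and breaks
   orthogonality to [v0]. *)
have [z v4z v0z] : exists2 z, dot (a v4) z = 0 & dot (a v0) z != 0.
  case: hv4 => [-> | /dot_neq0[w hw]].
    by have [z] := dot_neq0 v00; exists z; rewrite // dot0l.
  exists (cross (a v4) w); first by rewrite dot_crossl.
  by rewrite dotC dot_cross_rot.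
have v3J : v3 \notin J.
  by case: (Xa) => <- // _; apply: contraNneq npar => ->; rewrite cross0r.
have [||s v2E] := orth2P npar (a := a v2).
- exact: orth_in.
- by apply: orth_in; rewrite // esym.
have [r v20] := crossP v00 bad.
have v03 : dot (a v0) (a v3) = 0.
  have := orth_in Xa v2D v3D e23; rewrite v20 dotZl => /eqP.
  rewrite mulf_eq0 => /orP[/eqP r0 | /eqP //].
  by have := nz_in Xa v2D v2J; rewrite v20 r0 scale0r eqxx.
have s0 : s != 0.
  by apply: contraNneq (nz_in Xa v2D v2J) => s0; rewrite v2E s0 scale0r.
(* The vector at [v2] follows that at [v3]: the factor [s] makes the curve start at [a], and both
   orthogonality relations at [v2] hold identically. At parameter 1 its cross product with the
   vector at [v0] is a nonzero multiple of the vector at [x]. *)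
pose c3 := linev (a v3) z; pose c2 := s%:P *: cross (cstv (a x)) c3.
pose c := upd (upd (fun y => cstv (a y)) v3 c3) v2 c2.
have cE y : c y = if y == v2 then c2 else if y == v3 then c3 else cstv (a y) by [].
apply: (@adh_move D good a c [:: v2; v3] 0) => //.
- rewrite !evc_upd evc_cst !evE scale0r addr0 upd_id -v2E; exact: upd_id.
- by move=> y; rewrite cE !inE negb_or => /andP[/negPf-> /negPf->].
- by move=> y; rewrite !inE => /orP[] /eqP->.
- move=> y u; rewrite !inE => /orP[] /eqP-> uD.
    move=> /(nbr2 uD)[->|->] t; rewrite !cE !eqxx !neqs !evE.
      by rewrite dotZl dotC dot_crossl mulr0.
    by rewrite dotZl dotC dot_crossr mulr0.
  move=> /(nbr3 uD)[->|->] t; rewrite !cE !eqxx !neqs !evE.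
    by rewrite dotZr dot_crossr mulr0.
  by rewrite dotC dotDr dotZr v4z mulr0 addr0 dotC (orth_in Xa).
have : evv 1 (cross (cstv (a v0)) (c v2)) != 0.
  rewrite cE eqxx !evE scale1r crossZr double_cross.
  rewrite [dot _ (a x)]dotC (orth_in Xa) // scale0r subr0 dotDr v03 add0r.
  by rewrite !scaler_eq0 !negb_or s0 v0z nz_in.
move=> /generic_vec; apply: genericW => t; rewrite evv_cross evE => gt Xt.
by apply: adh_id; split=> //; rewrite /evc [c v0]cE !neqs evE.
Qed.

(** Outside the positions of [turn_v2] and [turn_v3], the vector at [v4] is nonzero and parallel to
    that at [v0]. If [v3] and [v5] are parallel, [v4] can be turned about [v3], and [turn_v3]
    applies along the curve. Otherwise [v4] is a multiple of the cross product of [v3] and [v5];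
    then [v3] moves freely, and [v2] and [v4] follow. *)
Lemma adh_nonparallel a : realization D a ->
  adh (fun a => realization D a /\ cross (a v0) (a v2) != 0) a.
Proof.
move=> Xa; have [|npar] := eqVneq (cross (a x) (a v3)) 0; first exact: turn_v2.
have [v40|v40] := eqVneq (a v4) 0; first by apply: turn_v3 => //; left.
have [par4|] := eqVneq (cross (a v0) (a v4)) 0; last by move=> ?; apply: turn_v3 => //; right.
have [bad | gd] := eqVneq (cross (a v0) (a v2)) 0; last exact: adh_id.
have v00 := nz_in Xa v0D v0J; have v20 := nz_in Xa v2D v2J.
have v4J : v4 \notin J by case: (Xa) => <- //.
have v30 : a v3 != 0 by apply: contraNneq npar => ->; rewrite cross0r.
have v3J : v3 \notin J by case: (Xa) => <- //.
have [r v2E] := crossP v00 bad.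
have v03 : dot (a v0) (a v3) = 0.
  have := orth_in Xa v2D v3D e23; rewrite v2E dotZl => /eqP.
  rewrite mulf_eq0 => /orP[/eqP r0 | /eqP //].
  by move: v20; rewrite v2E r0 scale0r eqxx.
have [par3 | npar3] := eqVneq (cross (a v3) (a v5)) 0.
  have [q v5E] := crossP v30 par3; have [w v0w] := dot_neq0 v00.
  pose z := cross (a v3) w.
  pose c := upd (fun y => cstv (a y)) v4 (linev (a v4) z).
  have cE y : c y = if y == v4 then linev (a v4) z else cstv (a y) by [].
  apply: (@adh_move D good a c [:: v4] 0) => //.
  - by rewrite evc_upd evc_cst evE scale0r addr0 upd_id.
  - by move=> y; rewrite inE => /negPf; rewrite cE => ->.
  - by move=> y; rewrite inE => /eqP->.
  - have ox t : dot (a v4 + t *: z) (a v3) = 0.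
      by rewrite dotC dotDr dotZr dot_crossl (orth_in Xa) // mulr0 addr0.
    move=> y u; rewrite inE => /eqP-> uD /(nbr4 uD)[->|->] t; rewrite !cE eqxx neqs !evE //.
    by rewrite v5E dotZr ox mulr0.
  have : evv 1 (cross (cstv (a v0)) (c v4)) != 0.
    rewrite cE eqxx !evE scale1r crossDr par4 add0r double_cross.
    by rewrite v03 scale0r subr0 scaler_eq0 negb_or v0w.
  move=> /generic_vec; apply: genericW => t; rewrite evv_cross evE => gt Xt.
  apply: turn_v3 => //; first by rewrite /evc !cE !neqs !evE.
  by right; rewrite /evc [c v0]cE neqs evE.
have [||s v2F] := orth2P npar (a := a v2).
- exact: orth_in.
- by apply: orth_in; rewrite // esym.
have [||s' v4F] := orth2P npar3 (a := a v4).
- exact: orth_in.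
- by apply: orth_in; rewrite // esym.
have s0 : s != 0 by apply: contraNneq v20 => s0; rewrite v2F s0 scale0r.
have [z v0z] := dot_neq0 v00.
pose c3 := linev (a v3) z; pose c2 := s%:P *: cross (cstv (a x)) c3.
pose c4 := s'%:P *: cross c3 (cstv (a v5)).
pose c := upd (upd (upd (fun y => cstv (a y)) v3 c3) v4 c4) v2 c2.
have cE y : c y = if y == v2 then c2 else if y == v4 then c4 else
  if y == v3 then c3 else cstv (a y) by [].
apply: (@adh_move D good a c [:: v2; v3; v4] 0) => //.
- rewrite !evc_upd evc_cst !evE scale0r addr0 upd_id -v2F -v4F upd_id; exact: upd_id.
- by move=> y; rewrite cE !inE !negb_or => /and3P[/negPf-> /negPf-> /negPf->].
- by move=> y; rewrite !inE => /or3P[] /eqP->.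
- move=> y u; rewrite !inE => /or3P[] /eqP-> uD.
  + move=> /(nbr2 uD)[->|->] t; rewrite !cE !eqxx !neqs !evE.
      by rewrite dotZl dotC dot_crossl mulr0.
    by rewrite dotZl dotC dot_crossr mulr0.
  + move=> /(nbr3 uD)[->|->] t; rewrite !cE !eqxx !neqs !evE.
      by rewrite dotZr dot_crossr mulr0.
    by rewrite dotZr dot_crossl mulr0.
  + move=> /(nbr4 uD)[->|->] t; rewrite !cE !eqxx !neqs !evE.
      by rewrite dotZl dotC dot_crossl mulr0.
    by rewrite dotZl dotC dot_crossr mulr0.
have : evv 1 (cross (cstv (a v0)) (c v2)) != 0.
  rewrite cE eqxx !evE scale1r crossZr double_cross.
  rewrite [dot _ (a x)]dotC (orth_in Xa) // scale0r subr0 dotDr v03 add0r.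
  by rewrite !scaler_eq0 !negb_or s0 v0z nz_in.
move=> /generic_vec; apply: genericW => t; rewrite evv_cross evE => gt Xt.
by apply: adh_id; split=> //; rewrite /evc [c v0]cE !neqs evE.
Qed.

End Closing.

(** A loop at [v0] or [v2] turns the step into a leaf, and a loop at [x] leaves nothing to choose.
    Otherwise the dense part required by [irr_extend] is the nonparallel position, where [orth2P]
    determines the new vector up to a scalar. *)
Lemma irr_close D (x v0 v2 v3 v4 v5 : V) : irr (realization D) -> x \notin D ->
  uniq [:: x; v0; v2; v3; v4; v5] -> {subset [:: v0; v2; v3; v4; v5] <= D} ->
  e x v0 -> e x v2 -> e v2 v3 -> e v3 v4 -> e v4 v5 ->
  (forall y, y \in D -> e x y -> y = v0 \/ y = v2) ->
  (forall y, y \in D -> e v2 y -> y = v3) ->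
  (forall y, y \in D -> e v3 y -> y = v2 \/ y = v4) ->
  (forall y, y \in D -> e v4 y -> y = v3 \/ y = v5) ->
  irr (realization (x |: D)).
Proof.
move=> irrD xD u6 sD e0 e2 e23 e34 e45 nx n2 n3 n4.
have v0D : v0 \in D by apply: sD; rewrite !inE eqxx.
have v2D : v2 \in D by apply: sD; rewrite !inE eqxx orbT.
have v3D : v3 \in D by apply: sD; rewrite !inE eqxx !orbT.
have v4D : v4 \in D by apply: sD; rewrite !inE eqxx !orbT.
have [v0J | v0J] := boolP (v0 \in J).
  have [v2J | v2J] := boolP (v2 \in J).
    by apply: irr_leaf0 => // y yD /(nx y yD)[->|->].
  apply: (irr_leaf1 (p := v2)) => // y yD /(nx y yD)[->|->]; [by right | by left].
have [v2J | v2J] := boolP (v2 \in J).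
  apply: (irr_leaf1 (p := v0)) => // y yD /(nx y yD)[->|->]; [by left | by right].
have [xJ | xJ] := boolP (x \in J).
  pose phi (_ : V -> 'rV[F]_3) (_ : 'rV[F]_3) : 'rV[F]_3 := 0.
  apply: (@irr_extend _ _ _ _ x true phi irrD).
  - by move=> c u; exists 0 => t; apply/rowP => i; rewrite !mxE /horner_eval horner0.
  - by move=> a; apply: realizationS; apply: subsetUr.
  - move=> a Xa; apply: adh_id; split=> //; exists 0.
    by apply/eqP; case: Xa => ->; rewrite // setU11.
  - move=> c u Xc _; apply: realization_upd; rewrite ?eqxx // => y _ _.
    by rewrite dot0l.
  - by [].
(* Parameters in [irr_extend] are vectors; the first coordinate serves as the scalar. *)
pose phi (v : V -> 'rV[F]_3) (u : 'rV[F]_3) := u 0 0 *: cross (v v0) (v v2).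
apply: (@irr_extend _ _ _ _ x false phi irrD).
- move=> c u; exists (u 0 0 *: cross (c v0) (c v2)) => t.
  by rewrite !evE /phi [evv t u 0 0]mxE.
- by move=> a; apply: realizationS; apply: subsetUr.
- move=> a Xa.
  have v0D' : v0 \in x |: D by rewrite inE v0D orbT.
  have v2D' : v2 \in x |: D by rewrite inE v2D orbT.
  suff : adh (fun a => realization (x |: D) a /\ cross (a v0) (a v2) != 0) a.
    apply: adhW => b [Xb nb]; split=> //; case: Xb => _ orth.
    have [||s ->] := orth2P nb (a := b x).
    + by apply: orth; rewrite ?setU11 // esym.
    + by apply: orth; rewrite ?setU11 // esym.
    by exists (s *: delta_mx 0 0); rewrite /phi !mxE eqxx mulr1.
  apply: (@adh_nonparallel _ x v0 v2 v3 v4 v5) => //.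
  + by move=> y; rewrite inE in_setU1 => /orP[-> // | /sD ->]; rewrite orbT.
  + by move=> y; rewrite in_setU1 => /predU1P[-> | yD /(n2 _ yD)]; [left | right].
  + move=> y; rewrite in_setU1 => /predU1P[-> | yD /(n3 _ yD)] //.
    rewrite esym => /(nx _ v3D)[] E.
      by move: u6; rewrite E /= !inE eqxx ?orbT ?andbF.
    by move: u6; rewrite E /= !inE eqxx ?orbT ?andbF.
  + move=> y; rewrite in_setU1 => /predU1P[-> | yD /(n4 _ yD)] //.
    rewrite esym => /(nx _ v4D)[] E.
      by move: u6; rewrite E /= !inE eqxx ?orbT ?andbF.
    by move: u6; rewrite E /= !inE eqxx ?orbT ?andbF.
- move=> c u Xc nz; apply: realization_upd => //; first by rewrite (negPf (nz isT)) (negPf xJ).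
  move=> y yD /(nx y yD)[->|->]; rewrite /phi dotZl dotC ?dot_crossl ?dot_crossr mulr0 //.
- by move=> a [nz _] _; rewrite nz // setU11.
Qed.

End GraphRealizations.

(** * Cacti inside a fixed ground set *)

Local Open Scope nat_scope.

(** The order of construction depends on the graph alone, so one order serves every field and every
    set of loops. [build_close] records only the stretch of the cycle next to [x], on which [v2],
    [v3] and [v4] still have degree two. *)
Inductive buildable (V : finType) (e : rel V) : {set V} -> Prop :=
| build_empty : buildable e set0
| build_leaf D x : buildable e D -> x \notin D ->
    (forall y z, y \in D -> z \in D -> e x y -> e x z -> y = z) ->
    buildable e (x |: D)
| build_close D x v0 v2 v3 v4 v5 : buildable e D -> x \notin D ->
    uniq [:: x; v0; v2; v3; v4; v5] -> {subset [:: v0; v2; v3; v4; v5] <= D} ->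
    e x v0 -> e x v2 -> e v2 v3 -> e v3 v4 -> e v4 v5 ->
    (forall y, y \in D -> e x y -> y = v0 \/ y = v2) ->
    (forall y, y \in D -> e v2 y -> y = v3) ->
    (forall y, y \in D -> e v3 y -> y = v2 \/ y = v4) ->
    (forall y, y \in D -> e v4 y -> y = v3 \/ y = v5) ->
    buildable e (x |: D).

Lemma buildable_irr (F : numFieldType) (V : finType) (e : rel V) (J D : {set V}) :
  symmetric e -> irreflexive e -> buildable e D ->
  irr (@realization F V e J D).
Proof.
move=> esym eirr; elim=> {D} [| D x _ irrD xD nx |].
- move=> f g a b rf rg _ _ fa gb.
  have [c [_ fc gc]] := @irr_all F V f g a b rf rg I I fa gb.
  by exists c; split=> //; split=> [y | y z]; rewrite inE.
- have [p /and3P[pD exp pJ] | noP] := pickP [pred p | [&& p \in D, e x p & p \notin J]].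
    by apply: (irr_leaf1 esym eirr (p := p)) => // y yD exy; left; apply: nx.
  apply: irr_leaf0 => // y yD exy; apply: contraFT (noP y) => yJ.
  by rewrite /= yD exy.
- move=> D x v0 v2 v3 v4 v5 _ irrD; exact: irr_close.
Qed.

Section Cact.
Variable T : finType.
Implicit Types (B S L : {set T}) (Ls : {set {set T}}) (l : nat -> {set T}) (p : nat -> T).

(* Cycles are indexed by [0, n); [l i] and [l (i.+1 %% n)] meet in [p i]. *)
Definition cycle_shape n l p : Prop :=
  [/\ 2 < n,
      forall i j, i < n -> j < n -> (p i \in l j) = (j == i) || (j == i.+1 %% n) &
      forall i j x, i < n -> j < n -> i != j -> x \in l i -> x \in l j ->
        exists2 k, k < n & x = p k].

Definition cycle_pts n l : {set T} := \bigcup_(i < n) l i.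

Definition cycle_lines n l : {set {set T}} := [set l i | i : 'I_n].

(** Points and lines live in one fixed type, without matroids. Meeting the old part in at most one
    point, rather than exactly one, makes the empty configuration a uniform start and admits several
    components. *)
Inductive cact : {set T} -> {set {set T}} -> Prop :=
| cact_empty : cact set0 set0
| cact_line B Ls L : cact B Ls -> 1 < #|L| -> #|L :&: B| <= 1 ->
    cact (B :|: L) (L |: Ls)
| cact_cycle B Ls n l p : cact B Ls -> cycle_shape n l p ->
    #|cycle_pts n l :&: B| <= 1 ->
    cact (B :|: cycle_pts n l) (Ls :|: cycle_lines n l).

Lemma cycle_ptsP n l x : reflect (exists2 i, i < n & x \in l i) (x \in cycle_pts n l).
Proof.
apply: (iffP bigcupP) => [[i _ xi] | [i lin xi]]; first by exists i.
by exists (Ordinal lin).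
Qed.

Lemma cycle_linesP n l L : reflect (exists2 i, i < n & L = l i) (L \in cycle_lines n l).
Proof.
apply: (iffP imsetP) => [[i _ ->] | [i lin ->]]; first by exists i.
by exists (Ordinal lin).
Qed.

Lemma modnS_small i n : i < n -> i.+1 %% n = if i.+1 == n then 0 else i.+1.
Proof.
move=> lin; case: eqP => [->|ne]; first by rewrite modnn.
by rewrite modn_small //; lia.
Qed.

Lemma cycle_p_inj n l p i j : cycle_shape n l p -> i < n -> j < n -> p i = p j -> i = j.
Proof.
move=> [n2 pl _] lin ljn pij.
have := pl i j lin ljn; rewrite pij pl // eqxx /=.
have := pl j i ljn lin; rewrite -pij pl // eqxx /=.
rewrite !modnS_small //; case: (i.+1 =P n) => ?; case: (j.+1 =P n) => ?; lia.
Qed.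

Lemma cycle_l_inj n l p i j : cycle_shape n l p -> i < n -> j < n -> l i = l j -> i = j.
Proof.
move=> [n2 pl _] lin ljn lij.
have := pl i j lin ljn; rewrite -lij pl // eqxx /=.
have := pl j i ljn lin; rewrite lij pl // eqxx /=.
rewrite !modnS_small //; case: (i.+1 =P n) => ?; case: (j.+1 =P n) => ?; lia.
Qed.

(** Renumbering brings the point of attachment to [l 0], and to [p 0] if it lies on two lines of the
    cycle. *)
Lemma cycle_rot n l p r : cycle_shape n l p -> r < n ->
  cycle_shape n (fun i => l ((i + r) %% n)) (fun i => p ((i + r) %% n)).
Proof.
move=> [n2 pl int] lrn; have n0 : 0 < n by lia.
have rotE i j : i < n -> j < n -> ((i + r) %% n == (j + r) %% n) = (i == j).
  by move=> lin ljn; rewrite eqn_modDr !modn_small.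
split=> // [i j lin ljn | i j x lin ljn nij xi xj].
  rewrite pl ?ltn_mod // rotE //; congr (_ || _).
  by rewrite -addn1 modnDml addnAC addn1 eqn_modDr modn_small.
have [|||k lkn ->] := int _ _ _ _ _ _ xi xj; rewrite ?ltn_mod ?rotE //.
exists ((k + (n - r)) %% n); rewrite ?ltn_mod // modnDml -addnA subnK 1?ltnW //.
by rewrite modnDr modn_small.
Qed.

Lemma cycle_rot_pts n l r : r < n ->
  cycle_pts n (fun i => l ((i + r) %% n)) = cycle_pts n l.
Proof.
move=> lrn; have n0 : 0 < n by lia.
apply/setP => x; apply/cycle_ptsP/cycle_ptsP => -[i lin xi].
  by exists ((i + r) %% n); rewrite ?ltn_mod.
exists ((i + (n - r)) %% n); rewrite ?ltn_mod // modnDml -addnA subnK 1?ltnW //.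
by rewrite modnDr modn_small.
Qed.

Lemma cycle_rot_lines n l r : r < n ->
  cycle_lines n (fun i => l ((i + r) %% n)) = cycle_lines n l.
Proof.
move=> lrn; have n0 : 0 < n by lia.
apply/setP => x; apply/cycle_linesP/cycle_linesP => -[i lin xi].
  by exists ((i + r) %% n); rewrite ?ltn_mod.
exists ((i + (n - r)) %% n); rewrite ?ltn_mod // modnDml -addnA subnK 1?ltnW //.
by rewrite modnDr modn_small.
Qed.

Lemma cycle_line_card n l p i : cycle_shape n l p -> i < n -> 1 < #|l i|.
Proof.
move=> cyc lin; have [n2 pl _] := cyc.
pose j := (i + n.-1) %% n; have ljn : j < n by rewrite ltn_mod; lia.
have ij : i != j.
  rewrite -[X in X != _](modn_small lin) -[X in X %% n != _]addn0 eqn_modDl mod0n.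
  by rewrite modn_small; lia.
have pi : p i \in l i by rewrite pl // eqxx.
have pj : p j \in l i.
  rewrite pl // /j -addn1 modnDml -addnA addn1 prednK; last by lia.
  by rewrite modnDr (modn_small lin) eqxx orbT.
rewrite (cardD1 (p i)) pi (cardD1 (p j)) !inE pj andbT.
by rewrite (contra_neq _ ij) // => /(cycle_p_inj cyc ljn lin).
Qed.

Lemma cact_lines B Ls L : cact B Ls -> L \in Ls -> L \subset B /\ 1 < #|L|.
Proof.
elim=> {B Ls} [| B Ls L' _ IH L'1 _ | B Ls n l p _ IH cyc _]; first by rewrite inE.
  rewrite in_setU1 => /predU1P[-> | /IH[sLB L1]]; first by rewrite subsetUr.
  by rewrite subsetU ?sLB.
rewrite in_setU => /orP[/IH[sLB L1] | /cycle_linesP[i lin ->]].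
  by rewrite subsetU ?sLB.
split; last exact: cycle_line_card cyc lin.
apply/subsetP => x xi; rewrite inE; apply/orP; right.
by apply/cycle_ptsP; exists i.
Qed.

Lemma card_le1_eq S x y : #|S| <= 1 -> x \in S -> y \in S -> x = y.
Proof. by move=> /card_le1_eqP uS xS yS; apply: (uS y x yS xS). Qed.

Definition levi : rel (T + {set T}) := fun v w =>
  match v, w with
  | inl x, inr L => x \in L
  | inr L, inl x => x \in L
  | _, _ => false
  end.

Lemma levi_sym : symmetric levi. Proof. by case=> [x|L] [y|L']. Qed.

Lemma levi_irr : irreflexive levi. Proof. by case. Qed.

Definition vert B Ls : {set T + {set T}} :=
  [set v | match v with inl x => x \in B | inr L => L \in Ls end].

Lemma in_vert_point B Ls x : (inl x \in vert B Ls) = (x \in B).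
Proof. by rewrite inE. Qed.

Lemma in_vert_line B Ls L : (inr L \in vert B Ls) = (L \in Ls).
Proof. by rewrite inE. Qed.

Lemma vert_point B Ls x : inl x |: vert B Ls = vert (x |: B) Ls.
Proof. by apply/setP => -[y|L]; rewrite !inE. Qed.

Lemma vert_line B Ls L : inr L |: vert B Ls = vert B (L |: Ls).
Proof. by apply/setP => -[y|L']; rewrite !inE. Qed.

Lemma build_point B Ls x : buildable levi (vert B Ls) ->
  (x \notin B -> forall L L', L \in Ls -> L' \in Ls -> x \in L -> x \in L' -> L = L') ->
  buildable levi (vert (x |: B) Ls).
Proof.
move=> bB uL; have [xB | xB] := boolP (x \in B).
  by rewrite (setUidPr _) // sub1set.
rewrite -vert_point; apply: build_leaf; rewrite ?inE //.
by move=> [y|L] [z|L']; rewrite !inE //= => LLs L'Ls xL xL'; rewrite (uL xB L L').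
Qed.

Lemma build_line B Ls L : buildable levi (vert B Ls) -> L \notin Ls ->
  (forall x y, x \in B -> y \in B -> x \in L -> y \in L -> x = y) ->
  buildable levi (vert B (L |: Ls)).
Proof.
move=> bB LLs uL; rewrite -vert_line; apply: build_leaf; rewrite ?inE //.
by move=> [y|L1] [z|L2]; rewrite !inE //= => yB zB yL zL; rewrite (uL y z).
Qed.

Lemma build_points B Ls S : buildable levi (vert B Ls) ->
  (forall x L L', x \in S -> x \notin B -> L \in Ls -> L' \in Ls ->
    x \in L -> x \in L' -> L = L') ->
  buildable levi (vert (B :|: S) Ls).
Proof.
move=> bB uS; suff H (s : seq T) : {subset s <= S} -> buildable levi (vert (B :|: [set:: s]) Ls).
  have -> : S = [set:: enum S] by apply/setP => x; rewrite inE mem_enum.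
  by apply: H => x; rewrite mem_enum.
elim: s => [|x s IH] sS.
  by rewrite (_ : [set:: _] = set0) ?setU0 //; apply/setP => x; rewrite !inE.
rewrite set_cons setUCA; apply: build_point.
  by apply: IH => y ys; apply: sS; rewrite inE ys orbT.
rewrite inE negb_or => /andP[xB _] L L'; apply: uS => //.
by apply: sS; rewrite inE eqxx.
Qed.

(** The order is [l 0], [p 0], [l 1] and so on up to [l (n - 1)], each a leaf unless already
    present; then [p (n - 1)] closes the cycle, and the remaining points are leaves on their lines.
    The last hypothesis keeps old points away from the later lines, so that the vertices near the
    end have degree two. *)
Lemma build_cycle B Ls n l p :
  buildable levi (vert B Ls) -> (forall L, L \in Ls -> L \subset B) ->
  cycle_shape n l p -> #|cycle_pts n l :&: B| <= 1 ->
  (forall x i, x \in B -> i < n -> x \in l i -> i = 0 \/ i = 1 /\ x = p 0) ->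
  buildable levi (vert (B :|: cycle_pts n l) (Ls :|: cycle_lines n l)).
Proof.
move=> bB sLs cyc B1 att; have [n2 pl int] := cyc.
have plS i j : i.+1 < n -> j < n -> (p i \in l j) = (j == i) || (j == i.+1).
  by move=> lin ljn; rewrite pl ?(modn_small lin) //; lia.
have lU i : i < n -> l i \subset cycle_pts n l.
  by move=> lin; apply/subsetP => x xi; apply/cycle_ptsP; exists i.
have lLs i : i < n -> l i \notin Ls.
  move=> lin; apply/negP => /sLs sB.
  have := cycle_line_card cyc lin; rewrite ltnNge (leq_trans _ B1) //.
  by apply: subset_leq_card; rewrite subsetI lU.
pose Bk k := B :|: [set:: [seq p i | i <- iota 0 k]].
pose Lk k := Ls :|: [set:: [seq l i | i <- iota 0 k]].
have BkP k x : reflect (x \in B \/ exists2 i, i < k & x = p i) (x \in Bk k).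
  rewrite !inE; apply: (iffP orP) => [] [xB | xk]; try by left.
    by case/mapP: xk => i; rewrite mem_iota => /= lik ->; right; exists i.
  by case: xk => i lik ->; right; apply: map_f; rewrite mem_iota.
have LkP k L : reflect (L \in Ls \/ exists2 i, i < k & L = l i) (L \in Lk k).
  rewrite !inE; apply: (iffP orP) => [] [xB | xk]; try by left.
    by case/mapP: xk => i; rewrite mem_iota => /= lik ->; right; exists i.
  by case: xk => i lik ->; right; apply: map_f; rewrite mem_iota.
have BkS k : Bk k.+1 = p k |: Bk k.
  by apply/setP => x; rewrite /Bk -addn1 iotaD map_cat !inE mem_cat !inE add0n orbA orbC.
have LkS k : Lk k.+1 = l k |: Lk k.
  by apply/setP => x; rewrite /Lk -addn1 iotaD map_cat !inE mem_cat !inE add0n orbA orbC.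
have lLk k : k < n -> l k \notin Lk k.
  move=> lkn; apply/LkP => -[|[i lik]]; first exact/negP/lLs.
  have lin : i < n by lia.
  by move=> /(cycle_l_inj cyc lkn lin); lia.
have path k : k < n -> buildable levi (vert (Bk k) (Lk k.+1)).
  elim: k => [|k IH] lkn; rewrite LkS.
    have -> : Bk 0 = B by apply/setP => x; rewrite !inE orbF.
    have -> : Lk 0 = Ls by apply/setP => x; rewrite !inE orbF.
    apply: build_line => //; first exact: lLs.
    move=> x y xB yB xl yl; apply: (card_le1_eq B1); rewrite inE ?xB ?yB andbT.
      exact: (subsetP (lU 0 _)).
    exact: (subsetP (lU 0 _)).
  apply: build_line; rewrite ?lLk //.
    rewrite BkS; apply: build_point; first by apply: IH; lia.
    move=> pkB L L' /LkP[/sLs/subsetP sLB|[i lik ->]].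
      by move=> _ /sLB pB; case/BkP: pkB; left.
    move=> /LkP[/sLs/subsetP sLB|[j ljk ->]].
      by move=> _ /sLB pB; case/BkP: pkB; left.
    by rewrite !plS; try lia; move=> hi hj; congr l; lia.
  suff H x : x \in Bk k.+1 -> x \in l k.+1 -> x = p k.
    by move=> x y /H hx /H hy /hx-> /hy->.
  case/BkP => [xB xl | [i lik ->]].
    by have [|[[->] ->]] := att x _ xB lkn xl; [lia|].
  by rewrite plS; try lia; move=> h; congr p; lia.
have [m nE] : exists m, n = m.+3 by exists (n - 3); lia.
have pl_last j : j < n -> (p m.+2 \in l j) = (j == m.+2) || (j == 0).
  by move=> ljn; rewrite pl // nE ?modnn.
have B_l x i : 1 < i < n -> x \in B -> x \notin l i.
  by move=> hi xB; apply/negP => xi; have [] := att x i xB _ xi; lia.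
have pB i : 0 < i < n -> p i \notin B.
  move=> hi; apply/negP => pB; have [|||] := att (p i) i pB; rewrite ?pl ?eqxx //; try lia.
  by move=> [_ /(cycle_p_inj cyc)]; lia.
have closed : buildable levi (vert (Bk n) (Lk n)).
  rewrite {1}nE BkS -vert_point.
  (* With [n = m.+3], the closing point [p (n - 1)] lies on [l 0] and [l (n - 1)], and the path runs
     backwards through [p (n - 2)], [l (n - 2)] and [p (n - 3)]. For [n = 3] these six vertices are
     the whole Levi cycle. *)
  apply: (@build_close _ _ _ _ (inr (l 0)) (inr (l m.+2)) (inl (p m.+1))
    (inr (l m.+1)) (inl (p m))).
  - by have := path m.+2; rewrite -nE; apply; lia.
  - rewrite inE; apply/BkP => -[|[i lim]]; first by apply/negP/pB; lia.
    by move=> /(cycle_p_inj cyc); lia.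
  - have ne_p i j : i < n -> j < n -> (inl (p i) == inl (p j) :> T + {set T}) = (i == j).
      move=> lin ljn; apply/eqP/eqP => [[] /(cycle_p_inj cyc lin ljn) // | -> //].
    have ne_l i j : i < n -> j < n -> (inr (l i) == inr (l j) :> T + {set T}) = (i == j).
      move=> lin ljn; apply/eqP/eqP => [[] /(cycle_l_inj cyc lin ljn) // | -> //].
    rewrite /= !inE !ne_p ?ne_l; try lia.
    by rewrite !orbF /=; lia.
  - have lin i : i < n -> l i \in Lk n.
      by move=> lin; apply/LkP; right; exists i.
    have pin i : i < m.+2 -> p i \in Bk m.+2.
      by move=> lin'; apply/BkP; right; exists i.
    move=> v; rewrite !inE => /or4P[| | |/orP[]] /eqP->; rewrite ?lin ?pin //; lia.
  - by rewrite /= pl_last; lia.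
  - by rewrite /= pl_last; lia.
  - by rewrite /= plS; lia.
  - by rewrite /= plS; lia.
  - by rewrite /= plS; lia.
  - move=> [y|L]; rewrite inE //= => /LkP[/sLs/subsetP sLB /sLB | [i lin ->]].
      by rewrite (negPf (pB _ _)) //; lia.
    by rewrite pl_last // => /orP[]/eqP->; [right | left].
  - move=> [y|L]; rewrite inE //= => /BkP[yB | [i lin ->]].
      by rewrite (negPf (B_l _ _ _ _)) //; lia.
    by rewrite plS; try lia; move=> h; congr (inl (p _)); lia.
  - move=> [y|L]; rewrite inE //= => /LkP[/sLs/subsetP sLB /sLB | [i lin ->]].
      by rewrite (negPf (pB _ _)) //; lia.
    by rewrite plS; try lia; move=> /orP[]/eqP->; [right | left].
  - move=> [y|L]; rewrite inE //= => /BkP[yB yl | [i lin ->]].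
      (* An old point on [l m.+1] forces [m = 0] and is [p 0], which is the vertex allowed as
         [v5]. *)
      have [||[[m0] ->]] := att _ _ yB _ yl; try lia.
      by right; rewrite m0.
    rewrite plS; try lia.
    by move=> /orP[]/eqP h; [left | right]; congr (inl (p _)); lia.
have -> : B :|: cycle_pts n l = Bk n :|: cycle_pts n l.
  apply/setP => x; rewrite !inE; case: (x \in B) => //=.
  case: mapP => // -[i]; rewrite mem_iota /= => lin ->.
  by apply/cycle_ptsP; exists i; rewrite ?pl ?eqxx.
have -> : Ls :|: cycle_lines n l = Lk n.
  apply/setP => L; rewrite !inE; congr (_ || _).
  apply/cycle_linesP/mapP => -[i]; rewrite ?mem_iota => lin ->; exists i => //.
  by rewrite mem_iota.
apply: build_points => // x L L' _ xB.
move=> /LkP[/sLs/subsetP sLB|[i lin ->]].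
  by move=> _ /sLB pB'; case/BkP: xB; left.
move=> /LkP[/sLs/subsetP sLB|[j ljn ->]].
  by move=> _ /sLB pB'; case/BkP: xB; left.
move=> xi xj; case: (eqVneq i j) => [-> // | nij].
by have [k lkn xk] := int _ _ _ lin ljn nij xi xj; case/BkP: xB; right; exists k.
Qed.

Lemma cact_buildable B Ls : cact B Ls -> buildable levi (vert B Ls).
Proof.
elim=> {B Ls} [| B Ls L cB IH L1 LB | B Ls n l p cB IH cyc UB].
- rewrite (_ : vert _ _ = set0); first exact: build_empty.
  by apply/setP => -[x|L]; rewrite !inE.
- have sLs L' : L' \in Ls -> L' \subset B by move=> /(cact_lines cB)[].
  (* The line vertex enters first, over at most one old point; it is then the only neighbour of each
     of its new points. *)
  apply: build_points.
    apply: build_line => //.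
      apply/negP => /sLs/setIidPl LBE; by move: LB; rewrite LBE leqNgt L1.
    by move=> x y xB yB xL yL; apply: (card_le1_eq LB); rewrite inE ?xL ?yL.
  move=> x L1' L2 xL xB /setU1P[->|/sLs/subsetP s1]; last by move=> _ /s1; rewrite (negPf xB).
  by move=> /setU1P[->|/sLs/subsetP s1] // _ /s1; rewrite (negPf xB).
- have sLs L' : L' \in Ls -> L' \subset B by move=> /(cact_lines cB)[].
  have [n2 pl int] := cyc; have n0 : 0 < n by lia.
  (* The shift is [j] if the attaching point is the junction [p j], the index of its only line in
     the cycle if it is no junction, and 0 if the cycle is disjoint from [B]. *)
  have [r lrn att] : exists2 r, r < n & forall x i, x \in B -> i < n ->
      x \in l ((i + r) %% n) -> i = 0 \/ i = 1 /\ x = p ((0 + r) %% n).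
    have [UB0 | [P PUB]] := set_0Vmem (cycle_pts n l :&: B).
      exists 0 => // x i xB lin; rewrite addn0 modn_small // => xi.
      have := in_set0 x; rewrite -UB0 inE xB andbT => /cycle_ptsP[]; by exists i.
    have PE x i : x \in B -> i < n -> x \in l i -> x = P.
      move=> xB lin xi; apply: (card_le1_eq UB) => //; rewrite inE xB andbT.
      by apply/cycle_ptsP; exists i.
    have := PUB; rewrite inE => /andP[/cycle_ptsP[k lkn Pk] _].
    have [/existsP[j /eqP PpE] | noP] := boolP [exists j : 'I_n, P == p j].
      exists j => // x i xB lin xi; have xP := PE _ _ xB (ltn_pmod _ n0) xi.
      move: xi; rewrite xP PpE pl ?ltn_mod // add0n (modn_small (ltn_ord j)).
      rewrite -[X in _ == X](modn_small (ltn_ord j)) -[X in _ == X %% n]add0n eqn_modDr mod0n.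
      rewrite -add1n eqn_modDr !(@modn_small i) // (@modn_small 1); last by lia.
      by case/orP => /eqP->; [left | right].
    exists k => // x i xB lin xi; left; have xP := PE _ _ xB (ltn_pmod _ n0) xi.
    apply/eqP; apply: contraNT noP => i0; rewrite xP in xi.
    have [|j ljn ->] := int _ k _ (ltn_pmod _ n0) lkn _ xi Pk.
      by rewrite -[X in _ != X](modn_small lkn) -[X in _ != X %% n]add0n eqn_modDr mod0n modn_small.
    by apply/existsP; exists (Ordinal ljn).
  rewrite -(cycle_rot_pts l lrn) -(cycle_rot_lines l lrn).
  apply: (build_cycle (p := fun i => p ((i + r) %% n))) => //.
    exact: cycle_rot.
  by rewrite cycle_rot_pts.
Qed.

End Cact.

(** * Triangles and colourings *)

Section Colouring.
Variable T : finType.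
Implicit Types (B U L : {set T}) (Ls : {set {set T}}).

(** All of [U] takes the colour of its point in [B], if there is one. *)
Lemma extend_colouring B U (chi : T -> 'I_3) : #|U :&: B| <= 1 ->
  exists2 chi' : T -> 'I_3, {in B, chi' =1 chi} & exists c, {in U, forall w, chi' w = c}.
Proof.
move=> UB; pose c := if [pick P in U :&: B] is Some P then chi P else ord0.
exists (fun w => if w \in B then chi w else c) => [w -> //|].
exists c => w wU; case: ifP => // wB; rewrite /c.
have wUB : w \in U :&: B by rewrite inE wU.
by case: pickP => [P PUB | /(_ w)]; [rewrite (card_le1_eq UB wUB PUB) | rewrite wUB].
Qed.

(** Colours stand for basis vectors: a colour missing on a line provides a normal for it, and points
    of three different colours become independent. *)
Definition triangle_colouring Ls x y z : Prop := exists chi : T -> 'I_3,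
  [/\ chi x = ord0, chi y = inord 1, chi z = inord 2 &
    forall L, L \in Ls -> exists c, {in L, forall w, chi w != c}].

Lemma const_missing U (chi : T -> 'I_3) : (exists c, {in U, forall w, chi w = c}) ->
  exists c, {in U, forall w, chi w != c}.
Proof.
move=> [c hc]; exists (if c == ord0 then inord 1 else ord0) => w /hc->.
by case: (c =P ord0) => [-> |/eqP //]; rewrite -val_eqE /= inordK.
Qed.

(** Such a triangle cannot be spread over several pieces. Either it lies in the old part, and the
    new piece receives a single colour, or its points are the corners of a new cycle with three
    lines, and the old part receives a single colour. *)
Lemma cact_colouring B Ls x y z Lxy Lxz Lyz : cact B Ls ->
  Lxy \in Ls -> Lxz \in Ls -> Lyz \in Ls ->
  x \in Lxy -> y \in Lxy -> z \notin Lxy ->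
  x \in Lxz -> z \in Lxz -> y \notin Lxz ->
  y \in Lyz -> z \in Lyz -> x \notin Lyz ->
  triangle_colouring Ls x y z.
Proof.
move=> cB.
elim: cB => {B Ls} [| B Ls L cB IH L1 LB | B Ls n l p cB IH cyc UB] /=; first by rewrite inE.
- move=> Lxy_in Lxz_in Lyz_in xLxy yLxy zLxy xLxz zLxz yLxz yLyz zLyz xLyz.
  have xy : x != y by apply: contraNneq yLxz => <-.
  have xz : x != z by apply: contraNneq zLxy => <-.
  have yz : y != z by apply: contraNneq zLxy => <-.
  have inB w L' L'' : w \in L' -> w \in L'' -> L' \in L |: Ls -> L'' \in L |: Ls ->
      L' != L'' -> w \in B.
    move=> wL' wL'' /setU1P[->|/(cact_lines cB)[/subsetP s _]]; last by move=> *; apply: s.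
    by move=> /setU1P[->|/(cact_lines cB)[/subsetP s _]]; rewrite ?eqxx // => *; apply: s.
  have xB : x \in B by apply: (inB x Lxy Lxz) => //; apply: contraNneq yLxz => <-.
  have yB : y \in B by apply: (inB y Lxy Lyz) => //; apply: contraNneq xLyz => <-.
  have zB : z \in B by apply: (inB z Lxz Lyz) => //; apply: contraNneq xLyz => <-.
  have inLs v w L' : v \in B -> w \in B -> v != w -> v \in L' -> w \in L' ->
      L' \in L |: Ls -> L' \in Ls.
    move=> vB wB vw vL wL /setU1P[LE|//].
    by case/eqP: vw; apply: (card_le1_eq LB); rewrite inE -LE ?vL ?wL.
  have [||||||||||||chi [cx cy cz cL]] := IH => //; try exact: (inLs x y); try exact: (inLs x z).
    exact: (inLs y z).
  have [chi' chiE cU] := extend_colouring chi LB.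
  exists chi'; rewrite !chiE //; split=> // L' /setU1P[-> | L'Ls]; first exact: const_missing.
  have [c hc] := cL L' L'Ls; exists c => w wL'.
  by rewrite chiE ?hc //; have [/subsetP->] := cact_lines cB L'Ls.
- set U := cycle_pts n l in UB *.
  move=> Lxy_in Lxz_in Lyz_in xLxy yLxy zLxy xLxz zLxz yLxz yLyz zLyz xLyz.
  have xy : x != y by apply: contraNneq yLxz => <-.
  have xz : x != z by apply: contraNneq zLxy => <-.
  have yz : y != z by apply: contraNneq zLxy => <-.
  have sub_B L w : L \in Ls -> w \in L -> w \in B.
    by move=> /(cact_lines cB)[/subsetP s _] /s.
  have two v w : v \in B -> w \in B -> v != w -> v \in U -> w \in U -> False.
    by move=> vB wB /eqP vw vU wU; apply: vw; apply: (card_le1_eq UB); rewrite inE ?vU ?wU.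
  have lineP L : L \in Ls :|: cycle_lines n l -> L \in Ls \/ exists2 i, i < n & L = l i.
    by rewrite inE => /orP[| /cycle_linesP]; [left | right].
  have inU i w : i < n -> w \in l i -> w \in U.
    by move=> lin wl; apply/cycle_ptsP; exists i.
  have [xyz|] := boolP [&& x \in B, y \in B & z \in B].
    have /and3P[xB yB zB] := xyz.
    have inLs v w L' : v \in B -> w \in B -> v != w -> v \in L' -> w \in L' ->
        L' \in Ls :|: cycle_lines n l -> L' \in Ls.
      move=> vB wB vw vL wL /lineP[//|[i lin LE]]; rewrite {}LE in vL wL.
      by case: (two v w); rewrite ?(inU i).
    have [||||||||||||chi [cx cy cz cL]] := IH => //; try exact: (inLs x y); try exact: (inLs x z).
      exact: (inLs y z).
    have [chi' chiE [c cU]] := extend_colouring chi UB.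
    exists chi'; rewrite !chiE //; split=> // L' /lineP[L'Ls | [i lin ->]].
      have [c' hc] := cL L' L'Ls; exists c' => w wL'.
      by rewrite chiE ?hc // (sub_B L').
    by apply: const_missing; exists c => w wl; apply: cU; apply: inU wl.
  move=> notB.
  (* If [Luv] were old, [u] and [v] would lie in [B] and [w] would not; the other two lines would
     then belong to the cycle and put both [u] and [v] into [U]. *)
  have third u v w Luv Luw Lvw : u != v -> Luv \in Ls :|: cycle_lines n l ->
      Luw \in Ls :|: cycle_lines n l -> Lvw \in Ls :|: cycle_lines n l ->
      u \in Luv -> v \in Luv -> u \in Luw -> w \in Luw -> v \in Lvw -> w \in Lvw ->
      ~~ [&& u \in B, v \in B & w \in B] -> exists2 i, i < n & Luv = l i.
    move=> uv /lineP[LLs|//] i2 i3 uL vL uL2 wL2 vL3 wL3.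
    rewrite (sub_B _ _ LLs uL) (sub_B _ _ LLs vL) /= => wB.
    case/lineP: i2 => [LLs2|[i lin LE]]; first by rewrite (sub_B _ _ LLs2 wL2) in wB.
    case/lineP: i3 => [LLs3|[j ljn LE']]; first by rewrite (sub_B _ _ LLs3 wL3) in wB.
    case: (two u v) => //; rewrite ?(sub_B Luv) //.
      by apply: (inU i); rewrite -?LE.
    by apply: (inU j); rewrite -?LE'.
  have [i lin Ei] : exists2 i, i < n & Lxy = l i by apply: (third x y z Lxy Lxz Lyz).
  have [j ljn Ej] : exists2 i, i < n & Lxz = l i.
    by apply: (third x z y Lxz Lxy Lyz) => //; rewrite [(z \in B) && _]andbC.
  have [k lkn Ek] : exists2 i, i < n & Lyz = l i.
    by apply: (third y z x Lyz Lxy Lxz) => //; rewrite andbA andbC.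
  move=> {IH}; rewrite {}Ei {}Ej {}Ek {Lxy_in Lxz_in Lyz_in third Lxy Lxz Lyz}
    in xLxy yLxy zLxy xLxz zLxz yLxz yLyz zLyz xLyz *.
  have ij : i != j by apply: contraNneq yLxz => <-.
  have ik : i != k by apply: contraNneq xLyz => <-.
  have jk : j != k by apply: contraNneq xLyz => <-.
  have [n2 pl int] := cyc.
  have [a lan xa] := int _ _ _ lin ljn ij xLxy xLxz.
  have [b lbn yb] := int _ _ _ lin lkn ik yLxy yLyz.
  have [c lcn zc] := int _ _ _ ljn lkn jk zLxz zLyz.
  have adj i' j' a' : i' < n -> j' < n -> i' != j' -> a' < n ->
      p a' \in l i' -> p a' \in l j' ->
      [\/ i'.+1 = j', j'.+1 = i', i' = 0 /\ j'.+1 = n | j' = 0 /\ i'.+1 = n].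
    move=> li' lj' /eqP ne la'; rewrite !pl // !modnS_small //.
    case: (a'.+1 =P n) => aE /orP[]/eqP iE /orP[]/eqP jE; subst i' j'; try by case: ne.
    - exact: Or44.
    - exact: Or43.
    - exact: Or41.
    - exact: Or42.
  (* Three distinct indices that are pairwise adjacent in cyclic order exist only for a triangle. *)
  have n3 : n = 3.
    rewrite xa in xLxy xLxz; rewrite yb in yLxy yLyz; rewrite zc in zLxz zLyz.
    have := adj _ _ _ lin ljn ij lan xLxy xLxz.
    have := adj _ _ _ lin lkn ik lbn yLxy yLyz.
    have := adj _ _ _ ljn lkn jk lcn zLxz zLyz.
    by clear -n2 lin ljn lkn ij ik jk; case=> ?; case=> ?; case=> ?; lia.
  (* The line [l k] has colour 2 except at [y], which has colour 1; all else is 0. So [l i] lacks 2,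
     because it meets [l k] only in [y], while [l j] lacks 1 and [l k] lacks 0. *)
  pose beta w : 'I_3 := if w == y then inord 1 else if w \in l k then inord 2 else ord0.
  have BU : #|B :&: U| <= 1 by rewrite setIC.
  have [chi chiE [c0 cB0]] := extend_colouring beta BU.
  have c12 : (inord 1 == inord 2 :> 'I_3) = false by rewrite -val_eqE /= !inordK.
  have c10 : (inord 1 == ord0 :> 'I_3) = false by rewrite -val_eqE /= !inordK.
  have c20 : (inord 2 == ord0 :> 'I_3) = false by rewrite -val_eqE /= !inordK.
  exists chi; rewrite !chiE ?(inU i x) ?(inU i y) ?(inU j z) //; split.
  + by rewrite /beta (negPf xy) (negPf xLyz).
  + by rewrite /beta eqxx.
  + by rewrite /beta eq_sym (negPf yz) zLyz.
  move=> L /lineP[LLs | [m lmn ->]].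
    by apply: const_missing; exists c0 => w wL; apply: cB0; apply: sub_B wL.
  have : [|| m == i, m == j | m == k].
    by clear -n3 lin ljn lkn ij ik jk lmn; lia.
  case/or3P => /eqP {m lmn}->.
  + exists (inord 2) => w wl; rewrite chiE ?(inU i) // /beta.
    case: (w =P y) => [_|wy]; first by rewrite c12.
    case: ifP => [wk|_]; last by rewrite eq_sym c20.
    have [b' lbn' wb'] := int _ _ _ lin lkn ik wl wk.
    case: wy; rewrite wb' yb; congr p.
    move: wl wk yLxy yLyz; rewrite wb' yb !pl // !modnS_small //.
    clear -lin lkn ik lbn lbn' n2; case: (b'.+1 =P n) => ?; case: (b.+1 =P n) => ?; lia.
  + exists (inord 1) => w wl; rewrite chiE ?(inU j) // /beta.
    case: (w =P y) => [wy|_]; first by move: yLxz; rewrite -wy wl.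
    by case: ifP => _; rewrite eq_sym ?c12 ?c10.
  + exists ord0 => w wl; rewrite chiE ?(inU k) // /beta wl.
    by case: (w =P y) => _; rewrite ?c10 ?c20.
Qed.

End Colouring.

(** * From matroids to cacti in a fixed ground set *)

Section Image.
Variables (T1 T2 : finType) (f : T1 -> T2).
Hypothesis finj : injective f.

Lemma cycle_shape_image n l (p : nat -> T1) : cycle_shape n l p ->
  cycle_shape n (fun i => f @: l i) (f \o p).
Proof.
case=> n2 pl int; split=> // [i j lin ljn | i j y lin ljn ij].
  by rewrite /= mem_imset // pl.
case/imsetP=> x xi ->; rewrite mem_imset // => xj.
by have [k lkn ->] := int _ _ _ lin ljn ij xi xj; exists k.
Qed.

Lemma cycle_pts_image n (l : nat -> {set T1}) :
  f @: cycle_pts n l = cycle_pts n (fun i => f @: l i).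
Proof.
apply/setP => y; apply/imsetP/cycle_ptsP => [[x + ->]|[i lin /imsetP[x xi ->]]].
  by case/cycle_ptsP=> i lin xi; exists i => //; apply: imset_f.
by exists x => //; apply/cycle_ptsP; exists i.
Qed.

Lemma cycle_lines_image n (l : nat -> {set T1}) :
  [set f @: L | L : {set T1} in cycle_lines n l] = cycle_lines n (fun i => f @: l i).
Proof.
apply/setP => y; apply/imsetP/cycle_linesP => [[x + ->]|[i lin ->]].
  by case/cycle_linesP=> i lin ->; exists i.
by exists (l i) => //; apply/cycle_linesP; exists i.
Qed.

Lemma cact_image (B : {set T1}) Ls :
  cact B Ls -> cact (f @: B) [set f @: L | L : {set T1} in Ls].
Proof.
elim=> {B Ls} [| B Ls L cB IH L1 LB | B Ls n l p cB IH cyc UB].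
- by rewrite !imset0; apply: cact_empty.
- rewrite imsetU imsetU1; apply: cact_line; rewrite ?card_imset //.
  by rewrite -imsetI ?card_imset // => ? ? _ _; apply: finj.
- rewrite !imsetU cycle_pts_image cycle_lines_image.
  apply: cact_cycle (cycle_shape_image cyc) _ => //.
  by rewrite -cycle_pts_image -imsetI ?card_imset // => ? ? _ _; apply: finj.
Qed.

End Image.

Lemma cact_union (T : finType) (B1 B2 : {set T}) L1 L2 :
  cact B1 L1 -> cact B2 L2 -> [disjoint B1 & B2] -> cact (B1 :|: B2) (L1 :|: L2).
Proof.
move=> c1; elim=> {B2 L2} [| B Ls L cB IH L2 LB | B Ls n l p cB IH cyc UB].
- by rewrite !setU0.
- rewrite -setI_eq0 setIUr setU_eq0 !setI_eq0 => /andP[dB dL].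
  rewrite setUA setUCA; apply: cact_line => //; first exact: IH.
  by rewrite setIUr (eqP (_ : L :&: B1 == set0)) ?set0U // setI_eq0 disjoint_sym.
- rewrite -setI_eq0 setIUr setU_eq0 !setI_eq0 => /andP[dB dL].
  rewrite !setUA; apply: cact_cycle cyc _; first exact: IH.
  by rewrite setIUr (eqP (_ : _ :&: B1 == set0)) ?set0U // setI_eq0 disjoint_sym.
Qed.

Section SimpleMatroids.
Variables (T : finType) (M : matroid T).
Hypothesis simpleM : simple_matroid M.
Implicit Types A C L : {set T}.

Lemma dependent_card A : dependent M A -> 2 < #|A|.
Proof.
move=> depA; have [C minC sCA] := minset_exists (P := dependent M) depA.
apply: leq_trans (subset_leq_card sCA); move/forall_inP: simpleM; apply.
by rewrite inE.
Qed.

Lemma circuit3 C : #|C| = 3 -> (C \in circuits M) = dependent M C.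
Proof.
move=> C3; rewrite inE; apply/idP/idP => [/minsetp // | depC].
apply/minsetP; split=> // B /dependent_card B2 sBC; apply/eqP.
by rewrite eqEcard sBC C3.
Qed.

(** In a simple matroid dependent sets have at least three elements, so dependent triples are
    already circuits and only triples have to be tested. *)
Lemma line_likeP A : reflect
  (2 < #|A| /\ forall C, C \subset A -> #|C| = 3 -> dependent M C) (line_like M A).
Proof.
apply: (iffP and3P) => [[_ A2 /forallP dA] | [A2 dA]].
  by split=> // C sCA C3; have := dA C; rewrite sCA C3 eqxx circuit3.
split=> //; last by apply/forallP => C; apply/implyP => /andP[sCA /eqP C3]; rewrite circuit3 ?dA.
have [C [sCA C3]] : exists C, C \subset A /\ #|C| = 3.
  have [x [y [z [[xA yA zA] [xy yz zx]]]]] := card_gt2P A2.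
  exists [set x; y; z]; split; first by rewrite !subUset !sub1set xA yA.
  by rewrite setUC cardsU1 cards2 !inE negb_or zx eq_sym yz xy.
by apply: contra (dA C sCA C3); apply: indepS.
Qed.

Lemma line_dependent L C : L \in lines M -> C \subset L -> #|C| = 3 -> dependent M C.
Proof. by rewrite inE => /maxsetp/line_likeP[_]; apply. Qed.

Lemma line_card L : L \in lines M -> 2 < #|L|.
Proof. by rewrite inE => /maxsetp/line_likeP[]. Qed.

Lemma dependent3_line C : #|C| = 3 -> dependent M C ->
  exists2 L, L \in lines M & C \subset L.
Proof.
move=> C3 depC; have lC : line_like M C.
  apply/line_likeP; rewrite C3; split=> // B sBC B3.
  by have -> : B = C by apply/eqP; rewrite eqEcard sBC B3 C3.
by have [L maxL sCL] := maxset_exists lC; exists L; rewrite // inE.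
Qed.

End SimpleMatroids.

Lemma single_line_lines (T : finType) (M : matroid T) :
  simple_matroid M -> single_line M -> lines M = [set setT].
Proof.
move=> sM /andP[T2 /eqP iM].
have lT : line_like M setT.
  apply/(line_likeP sM); rewrite cardsT; split=> // C _ C3.
  by rewrite /dependent iM inE C3.
apply/setP => L; rewrite !inE; apply/maxsetP/eqP => [[_ mL] | ->].
  by apply/esym/mL; rewrite ?subsetT.
by split=> // B _; rewrite subTset => /eqP.
Qed.

Lemma is_cycle_shape (T : finType) (M : matroid T) : is_cycle M ->
  exists n l p, [/\ cycle_shape n l p, lines M = cycle_lines n l & cycle_pts n l = [set: T]].
Proof.
move=> [n [l [p [n2 linj lE lp deg1]]]]; have n0 : 0 < n by lia.
pose o i := Ordinal (ltn_pmod i n0).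
have oE (i : 'I_n) : o i = i by apply/val_inj; rewrite /= modn_small.
exists n, (l \o o), (p \o o).
have linesE : lines M = cycle_lines n (l \o o).
  by rewrite lE; apply: eq_imset => i /=; rewrite oE.
have llines i : l i \in lines M by rewrite lE; apply: imset_f.
have pl (i j : 'I_n) : (p i \in l j) = (j == i) || (j == ordS i).
  have : (l j \in lines_at M (p i)) = (p i \in l j) by rewrite inE llines.
  by rewrite lp !inE !(inj_eq linj) => ->.
split=> //.
  split=> // [i j lin ljn | i j x lin ljn ij xi xj].
    by rewrite /= pl -!val_eqE /= (modn_small lin) (modn_small ljn).
  have : x \in codom p.
    apply: contraT => /deg1; rewrite /degree => d1.
    have : [set l (o i); l (o j)] \subset lines_at M x.
      by rewrite subUset !sub1set; apply/andP; split; apply/setIdP.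
    move/subset_leq_card; rewrite d1 cards2 (inj_eq linj) -val_eqE /=.
    by rewrite (modn_small lin) (modn_small ljn) ij.
  by case/codomP=> k ->; exists k; rewrite //= oE.
apply/setP => x; rewrite inE; apply/cycle_ptsP.
have [/codomP[k ->] | /deg1 d1] := boolP (x \in codom p).
  by exists k; rewrite //= oE pl eqxx.
have /card_gt0P[L] : 0 < #|lines_at M x| by rewrite -[#|_|]/(degree M x) d1.
rewrite inE lE => /andP[/imsetP[k _ ->] xk].
by exists k; rewrite //= oE.
Qed.

(** The images of the two ground sets share only the glued point, which meets the condition of a
    step of [cact]. *)
Lemma connected_cactus_cact (T : finType) (M : matroid T) :
  connected_cactus M -> cact [set: T] (lines M).
Proof.
elim=> {T M} [T M [/andP[sM _] [lM | /is_cycle_shape[n [l [p [cyc -> UE]]]]]] |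
  T1 T2 T M N p q K _ IH [/andP[sN _] hN] [_ [f [g [[finj ginj] fg cov ->]]]]].
- rewrite (single_line_lines sM lM).
  have := cact_line (L := setT) (@cact_empty T); rewrite set0U setU0 setI0 cards0; apply=> //.
  by rewrite cardsT; case/andP: lM => /ltnW.
- rewrite -UE -(set0U (cycle_pts n l)) -(set0U (cycle_lines n l)).
  by apply: cact_cycle cyc _; [apply: cact_empty | rewrite setI0 cards0].
have cM := cact_image finj IH.
have covE : [set: T] = f @: [set: T1] :|: g @: [set: T2].
  apply/setP => z; rewrite !inE; apply/esym/orP.
  by case: (cov z) => /codomP[x ->]; [left | right]; apply: imset_f.
have meet1 : #|g @: [set: T2] :&: f @: [set: T1]| <= 1.
  apply/card_le1_eqP => z1 z2 /setIP[/imsetP[y1 _ ->] /imsetP[x1 _ E1]].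
  move=> /setIP[/imsetP[y2 _ ->] /imsetP[x2 _ E2]].
  by have [_ ->] := proj1 (fg x1 y1) (esym E1); have [_ ->] := proj1 (fg x2 y2) (esym E2).
case: hN => [lN | /is_cycle_shape[n [l [r [cyc linesE UE]]]]].
  rewrite (single_line_lines sN lN) imset_set1 covE [X in cact _ X]setUC; apply: cact_line => //.
  by rewrite card_imset // cardsT; case/andP: lN => /ltnW.
rewrite covE linesE cycle_lines_image -UE cycle_pts_image.
apply: cact_cycle (cycle_shape_image ginj cyc) _ => //.
by rewrite -cycle_pts_image UE.
Qed.

Section Components.
Variables (T : finType) (M : matroid T).
Hypothesis simpleM : simple_matroid M.

Let S x := {y : T | y \in component M x}.

Lemma collinear_sym : symmetric (collinear M).
Proof.
by move=> x y; apply/exists_inP/exists_inP => -[L LM /andP[xL yL]]; exists L; rewrite ?xL ?yL.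
Qed.

Lemma restrict_simple C : simple_matroid (restrict M C).
Proof.
apply/forall_inP => A; rewrite inE => /minsetp; rewrite /dependent inE => dA.
by rewrite -(card_imset _ val_inj); apply: (dependent_card simpleM).
Qed.

Lemma line_component L x y : L \in lines M -> x \in L -> y \in L -> y \in component M x.
Proof.
move=> LM xL yL; rewrite inE; apply: connect1; apply/exists_inP.
by exists L; rewrite // xL.
Qed.

(** Maximality could differ between [M] and its restriction; it does not, because a line of [M] that
    meets a component lies inside it. *)
Lemma lines_component x : [set val @: (L : {set S x}) | L in lines (restrict M (component M x))] =
  [set L in lines M | L \subset component M x].
Proof.
have rsM := restrict_simple (component M x).
have valS (A : {set T}) : A \subset component M x -> exists A' : {set S x}, A = val @: A'.
  move=> /subsetP sA; exists (val @^-1: A); apply/setP => y; apply/idP/imsetP => [yA | [z]].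
    by exists (Sub y (sA y yA)); rewrite ?inE SubK.
  by rewrite inE => zA ->.
have likeE (A : {set S x}) : line_like (restrict M (component M x)) A = line_like M (val @: A).
  apply/(line_likeP rsM)/(line_likeP simpleM); rewrite card_imset; try exact: val_inj.
    move=> [A2 dA]; split=> // C sCA.
    have [|C' CE] := valS C.
      by apply: subset_trans sCA _; apply/subsetP => _ /imsetP[z _ ->]; apply: valP.
    rewrite CE card_imset; last exact: val_inj.
    move=> C3; have := dA C'; rewrite /dependent inE; apply=> //.
    apply/subsetP => y yC; have := subsetP sCA (val y).
    by rewrite CE !(mem_imset _ _ val_inj); apply.
  move=> [A2 dA]; split=> // C sCA C3; rewrite /dependent inE; apply: dA.
    exact: imsetS.
  by rewrite card_imset //; apply: val_inj.
apply/setP => L; apply/imsetP/setIdP => [[A AM ->] | [LM sLC]].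
  have sAC : val @: A \subset component M x by apply/subsetP => _ /imsetP[z _ ->]; apply: valP.
  split=> //; move: AM; rewrite !inE => /maxsetP[lA mA]; rewrite likeE in lA.
  have [B maxB sAB] := maxset_exists lA.
  have BM : B \in lines M by rewrite inE.
  have [z zA] : exists z, z \in A.
    apply/card_gt0P; rewrite -(card_imset _ val_inj).
    by have /(line_likeP simpleM)[/ltnW/ltnW] := lA.
  have [B' BE] : exists B' : {set S x}, B = val @: B'.
    apply: valS; apply/subsetP => y yB; rewrite inE.
    have : connect (collinear M) x (val z) by have := valP z; rewrite inE.
    move=> /connect_trans; apply; have := @line_component _ (val z) y BM _ yB; rewrite inE; apply.
    by apply: (subsetP sAB); apply: imset_f.
  suff <- : B' = A by rewrite -BE.
  apply: mA; first by rewrite likeE -BE (maxsetp maxB).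
  apply/subsetP => y yA; have : val y \in B by apply: (subsetP sAB); apply: imset_f.
  by rewrite BE mem_imset //; apply: val_inj.
have [A LE] := valS L sLC; exists A => //.
move: LM; rewrite !inE LE => /maxsetP[lL mL]; apply/maxsetP; split; first by rewrite likeE.
move=> B; rewrite likeE => lB sAB; apply: (imset_inj val_inj); apply: mL => //.
exact: imsetS.
Qed.

(** Components are disjoint and each line lies in one, so they are adjoined by [cact_union] while
    running over all points; a component met before is skipped. *)
Lemma cactus_cact : (forall x, connected_cactus (restrict M (component M x))) ->
  cact [set: T] (lines M).
Proof.
move=> cM.
pose U (s : seq T) := [set y | has (fun x => connect (collinear M) x y) s].
have symM : connect_sym (collinear M) by apply: sym_connect_sym; apply: collinear_sym.
suff H s : cact (U s) [set L in lines M | L \subset U s].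
  have := H (enum T); have -> : U (enum T) = [set: T].
    by apply/setP => x; rewrite !inE; apply/hasP; exists x; rewrite ?mem_enum.
  by rewrite (_ : [set L in _ | _] = lines M) //; apply/setP => L; rewrite inE subsetT andbT.
elim: s => [|x s IH].
  have -> : U [::] = set0 by apply/setP => y; rewrite !inE.
  rewrite (_ : [set L in _ | _] = set0); first exact: cact_empty.
  apply/setP => L; rewrite in_set0; apply/negP => /setIdP[/(line_card simpleM) L2].
  by rewrite subset0 => /eqP L0; rewrite L0 cards0 in L2.
have UE : U (x :: s) = U s :|: component M x by apply/setP => y; rewrite !inE /= orbC.
have closedU y z : connect (collinear M) y z -> y \in U s -> z \in U s.
  rewrite !inE => yz /hasP[w ws wy]; apply/hasP; exists w => //.
  exact: connect_trans yz.
have [xU | xU] := boolP (x \in U s).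
  rewrite UE (setUidPl _) //; apply/subsetP => y; rewrite inE => xy.
  exact: closedU xy xU.
have dis : [disjoint U s & component M x].
  rewrite disjoint_subset; apply/subsetP => y yU; rewrite !inE; apply: contra xU => xy.
  by apply: closedU yU; rewrite symM.
have cC : cact (component M x) [set L in lines M | L \subset component M x].
  have := cact_image val_inj (connected_cactus_cact (cM x)).
  rewrite lines_component (_ : _ @: _ = component M x) //.
  apply/setP => y; apply/imsetP/idP => [[z _ ->] | yC]; first exact: valP.
  by exists (Sub y yC); rewrite ?SubK.
rewrite (_ : [set L in lines M | L \subset U (x :: s)] = [set L in lines M | L \subset U s]
    :|: [set L in lines M | L \subset component M x]).
  by rewrite UE; apply: cact_union.
apply/setP => L; rewrite UE; apply/setIdP/setUP => [[LM /subsetP sL] | [] /setIdP[LM sL]].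
- have [z zL] : exists z, z \in L.
    by apply/card_gt0P; apply: leq_trans (line_card simpleM LM).
  have Lz y : y \in L -> connect (collinear M) z y.
    by move=> yL; have := line_component LM zL yL; rewrite inE.
  have := sL z zL; rewrite in_setU => /orP[zU | zC]; [left | right].
    by apply/setIdP; split=> //; apply/subsetP => y yL; apply: closedU (Lz y yL) zU.
  apply/setIdP; split=> //; apply/subsetP => y yL; move: zC; rewrite !inE.
  by move=> /connect_trans; apply; apply: Lz.
- by split=> //; rewrite subsetU ?sL.
- by split=> //; rewrite subsetU ?sL ?orbT.
Qed.

End Components.

(** * Realizations of a cactus matroid *)

(* Imported only here: mpoly shadows [symmetric]. *)
From mathcomp Require Import mpoly.
Local Open Scope ring_scope.

Lemma dot_suml (R : comNzRingType) (I : finType) (u : I -> 'rV[R]_3) (w : 'rV[R]_3) :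
  dot (\sum_i u i) w = \sum_i dot (u i) w.
Proof.
have dotDl (a b : 'rV[R]_3) : dot (a + b) w = dot a w + dot b w.
  by rewrite dotC dotDr !(dotC w).
by apply: (big_morph (fun a => dot a w) dotDl); apply: dot0l.
Qed.

(** * Linear dependence of rows, normals and minors *)

Section FreeRows.
Variables (F : fieldType) (d : nat).
Implicit Types (g : 'M[F]_(d, 3)) (A : {set 'I_d}).

Definition rows_of g A : 'M[F]_(#|A|, 3) := rowsub (@enum_val _ (mem A)) g.

Lemma row_rows_of g A i : row i (rows_of g A) = row (enum_val i) g.
Proof. by apply/rowP => j; rewrite !mxE. Qed.

Lemma lin_dependentE g A : lin_dependent g A = ~~ row_free (rows_of g A).
Proof.
have nthE (i : 'I_#|A|) : (image_tuple (fun i => row i g) A)`_i = row i (rows_of g A).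
  by rewrite row_rows_of /= nth_image.
congr (~~ _); apply/(@freeP _ _ _ (image_tuple (fun i => row i g) A))/idP => [fr | fr k k0 i].
  apply: inj_row_free => v; rewrite mulmx_sum_row => v0; apply/rowP => i.
  rewrite mxE; apply: (fr (v 0)); rewrite -[RHS]v0.
  by apply: eq_bigr => j _; rewrite nthE.
have : \row_j k j == 0.
  rewrite -(mulmx_free_eq0 _ fr) mulmx_sum_row -[X in _ == X]k0; apply/eqP.
  by apply: eq_bigr => j _; rewrite nthE mxE.
by move=> /eqP/rowP/(_ i); rewrite !mxE.
Qed.

(** Pairing a vanishing combination of the rows with the dual vector [w] isolates the coefficient at
    [a]. *)
Lemma free_dual g A :
  (forall a, a \in A -> exists w, dot (row a g) w != 0 /\
     forall b, b \in A -> b != a -> dot (row b g) w = 0) ->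
  ~~ lin_dependent g A.
Proof.
move=> dual; rewrite lin_dependentE negbK; apply: inj_row_free => v v0.
apply/rowP => i; have [w [wi wj]] := dual _ (enum_valP i).
have : dot (v *m rows_of g A) w = 0 by rewrite v0 dot0l.
rewrite mulmx_sum_row dot_suml (bigD1 i) //= big1 ?addr0 => [|j ji].
  by rewrite dotZl row_rows_of mxE => /eqP; rewrite mulf_eq0 (negPf wi) orbF => /eqP.
by rewrite dotZl row_rows_of wj ?mulr0 ?enum_valP // (inj_eq enum_val_inj).
Qed.

Lemma lin_dependent_gt3 g A : (3 < #|A|)%N -> lin_dependent g A.
Proof.
move=> A3; rewrite lin_dependentE; apply/negP => /eqP rk.
by have := rank_leq_col (rows_of g A); rewrite rk leqNgt A3.
Qed.

Lemma lin_dependent0 g A a : a \in A -> row a g = 0 -> lin_dependent g A.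
Proof.
move=> aA ga; rewrite lin_dependentE; apply/negP => fr.
have /eqP : (delta_mx 0 (enum_rank_in aA a) : 'rV[F]_#|A|) == 0.
  by rewrite -(mulmx_free_eq0 _ fr) -rowE row_rows_of enum_rankK_in // ga.
move=> /rowP/(_ (enum_rank_in aA a))/eqP.
by rewrite !mxE !eqxx oner_eq0.
Qed.

Lemma lin_dependent3 g A w : #|A| = 3 -> w != 0 ->
  (forall a, a \in A -> dot (row a g) w = 0) -> lin_dependent g A.
Proof.
move=> A3 w0 wA; rewrite lin_dependentE; apply/negP => /eqP rk.
have Bw : rows_of g A *m w^T = 0.
  apply/colP => i; rewrite !mxE -[RHS](wA _ (enum_valP i)) /dot.
  rewrite !big_ord_recl big_ord0 addr0 !mxE addrA.
  by congr (_ * _ + _ * _ + _ * _); congr (_ _ _); apply/val_inj.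
have := mulmx0_rank_max Bw; rewrite rk A3 mxrank_tr.
by rewrite -[X in (_ <= X)%N]addn0 leq_add2l leqn0 mxrank_eq0 (negPf w0).
Qed.

(** All triple products of rows in [L] vanish. If two rows are not parallel, their cross product is
    a normal; otherwise the rows span at most a line, and a vector orthogonal to one nonzero row
    suffices. *)
Lemma plane_exists g (L : {set 'I_d}) :
  (forall C : {set 'I_d}, C \subset L -> #|C| = 3 -> lin_dependent g C) ->
  exists2 w, w != 0 & forall i, i \in L -> dot (row i g) w = 0.
Proof.
move=> dep.
have det0 i j k : i \in L -> j \in L -> k \in L -> dot (cross (row i g) (row j g)) (row k g) = 0.
  move=> iL jL kL; apply/eqP; apply: contraT => nz.
  have ij : i != j.
    by apply: contraNneq nz => ->; rewrite -dot_cross_rot dotC dot_crossl.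
  have ik : i != k by apply: contraNneq nz => ->; rewrite dotC dot_crossl.
  have jk : j != k by apply: contraNneq nz => ->; rewrite dotC dot_crossr.
  have C3 : #|[set i; j; k]| = 3 by rewrite setUC cardsU1 cards2 !inE negb_or !(eq_sym k) ik jk ij.
  have sC : [set i; j; k] \subset L by rewrite !subUset !sub1set iL jL kL.
  suff : ~~ lin_dependent g [set i; j; k] by rewrite dep.
  have H a b c : dot (cross (row a g) (row b g)) (row c g) != 0 -> exists w,
      dot (row a g) w != 0 /\ (dot (row b g) w = 0 /\ dot (row c g) w = 0).
    move=> abc; exists (cross (row b g) (row c g)); rewrite dot_crossl dot_crossr.
    by rewrite dotC dot_cross_rot.
  apply: free_dual => a; rewrite !inE => /orP[/orP[]|] /eqP->.
  - have [w [? [? ?]]] := H _ _ _ nz; exists w; split=> // b.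
    by rewrite !inE => /orP[/orP[]|] /eqP->; rewrite ?eqxx.
  - have nz' : dot (cross (row j g) (row k g)) (row i g) != 0 by rewrite dot_cross_rot.
    have [w [? [? ?]]] := H _ _ _ nz'; exists w; split=> // b.
    by rewrite !inE => /orP[/orP[]|] /eqP->; rewrite ?eqxx.
  - have nz' : dot (cross (row k g) (row i g)) (row j g) != 0 by rewrite -dot_cross_rot.
    have [w [? [? ?]]] := H _ _ _ nz'; exists w; split=> // b.
    by rewrite !inE => /orP[/orP[]|] /eqP->; rewrite ?eqxx.
have [/existsP[i /existsP[j /and3P[iL jL nz]]] | par] :=
    boolP [exists i, exists j, [&& i \in L, j \in L & cross (row i g) (row j g) != 0]].
  by exists (cross (row i g) (row j g)) => // k kL; rewrite dotC det0.
have {}par i j : i \in L -> j \in L -> cross (row i g) (row j g) = 0.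
  move=> iL jL; apply/eqP; apply: contraNT par => nz.
  by apply/existsP; exists i; apply/existsP; exists j; rewrite iL jL.
have [i /andP[iL i0] | all0] := pickP [pred i | (i \in L) && (row i g != 0)].
  have [w w0 wi] := ex_orth (row i g); exists w => // j jL.
  by have [s ->] := crossP i0 (par i j iL jL); rewrite dotZl wi mulr0.
have [w w0 _] := ex_orth (0 : 'rV[F]_3); exists w => // i iL.
by have := all0 i; rewrite /= iL => /negbFE/eqP->; rewrite dot0l.
Qed.

Definition coord_mx : 'M[{mpoly F[d * 3]}]_(d, 3) := \matrix_(i, j) 'X_(mxvec_index i j).

Lemma meval_coord_mx g : map_mx (meval (mxvec g 0)) coord_mx = g.
Proof. by apply/matrixP => i j; rewrite !mxE mevalXU mxvecE. Qed.

(** Multiplying the rows by a right inverse [C] of their matrix at [g] gives a determinant equal to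
    1 at [g]; this combination of maximal minors spares selecting a nonzero one. *)
Lemma free_minor g A : ~~ lin_dependent g A -> exists P : {mpoly F[d * 3]},
  P.@[mxvec g 0] != 0 /\ forall h, P.@[mxvec h 0] != 0 -> ~~ lin_dependent h A.
Proof.
rewrite lin_dependentE negbK => /row_freeP[C gC].
pose P := \det (rowsub (@enum_val _ (mem A)) coord_mx *m map_mx (@mpolyC (d * 3) F) C).
have PE h : P.@[mxvec h 0] = \det (rows_of h A *m C).
  rewrite /P -det_map_mx map_mxM; congr (\det (_ *m _)).
    by rewrite /rows_of -[in RHS](meval_coord_mx h); apply/matrixP => i j; rewrite !mxE.
  by apply/matrixP => i j; rewrite !mxE; apply: mevalC.
exists P; rewrite PE gC det1 oner_eq0; split=> // h; rewrite PE -unitfE => u.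
rewrite lin_dependentE negbK; apply/row_freeP.
exists (C *m invmx (rows_of h A *m C)); rewrite mulmxA mulmxV //.
Qed.

End FreeRows.

Section Realizations.
Variables (F : numFieldType) (d : nat).
Notation V := ('I_d + {set 'I_d})%type.
Implicit Types (v : V -> 'rV[F]_3) (A : {set 'I_d}).

Definition points_mx v : 'M[F]_(d, 3) := \matrix_i v (inl i).

Lemma row_points_mx v i : row i (points_mx v) = v (inl i).
Proof. by rewrite rowK. Qed.

Lemma regular_meval (P : {mpoly F[d * 3]}) : regular (fun v => P.@[mxvec (points_mx v) 0]).
Proof.
move=> c; pose cm : 'M[{poly F}]_(d, 3) := \matrix_i c (inl i).
exists (\sum_(m <- msupp P) (P@_m)%:P * \prod_i mxvec cm 0 i ^+ m i) => t.
rewrite mevalE horner_sum; apply: eq_bigr => m _.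
rewrite hornerM hornerC horner_prod; congr (_ * _); apply: eq_bigr => k _.
rewrite horner_exp; congr (_ ^+ _); case/mxvec_indexP: k => i j.
by rewrite !mxvecE !mxE.
Qed.

Lemma regular_prod (I : Type) (s : seq I) (f : I -> (V -> 'rV[F]_3) -> F) :
  (forall i, regular (f i)) -> regular (fun v => \prod_(i <- s) f i v).
Proof.
move=> rf; elim: s => [|i s IH] c.
  by exists 1 => t; rewrite big_nil hornerC.
have [q fq] := rf i c; have [r gr] := IH c; exists (q * r) => t.
by rewrite big_cons hornerM fq gr.
Qed.

Lemma irr_prod (S : (V -> 'rV[F]_3) -> Prop) (I : eqType) (s : seq I)
    (f : I -> (V -> 'rV[F]_3) -> F) :
  irr S -> (exists a, S a) -> (forall i, regular (f i)) ->
  (forall i, i \in s -> exists2 a, S a & f i a != 0) ->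
  exists2 a, S a & \prod_(i <- s) f i a != 0.
Proof.
move=> irrS [a0 Sa0] rf; elim: s => [|i s IH] nz.
  by exists a0; rewrite ?big_nil ?oner_eq0.
have [a Sa fa] := nz i (mem_head _ _).
have [|b Sb pb] := IH; first by move=> j js; apply: nz; rewrite inE js orbT.
have [c [Sc fc pc]] := irrS _ _ a b (rf i) (regular_prod s rf) Sa Sb fa pb.
by exists c; rewrite // big_cons mulf_neq0.
Qed.

Variable M : matroid 'I_d.
Hypotheses (simpleM : simple_matroid M) (rankM : (rank M <= 3)%N).
Hypothesis cactM : cact [set: 'I_d] (lines M).

Implicit Types J : {set 'I_d}.

(** Only points become loops: the normal of a line must be nonzero even when all its points
    vanish. *)
Definition loop_vertices J : {set V} := [set inl x | x in J].

Definition levi_realization J : (V -> 'rV[F]_3) -> Prop :=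
  realization (@levi 'I_d) (loop_vertices J) (vert [set: 'I_d] (lines M)).

Let inl_loop_vertices J x : (inl x \in loop_vertices J) = (x \in J).
Proof. by rewrite mem_imset // => ? ? []. Qed.

Let inr_loop_vertices J L : (inr L \in loop_vertices J) = false.
Proof. by apply/imsetP => -[]. Qed.

Lemma realizationP J v :
  (forall x, (v (inl x) == 0) = (x \in J)) ->
  (forall L, L \in lines M -> v (inr L) != 0) ->
  (forall x L, L \in lines M -> x \in L -> dot (v (inl x)) (v (inr L)) = 0) ->
  levi_realization J v.
Proof.
move=> vJ nz orth; split=> [[x|L] | [x|L] [y|L']];
  rewrite ?in_vert_point ?in_vert_line ?in_setT //=.
- by rewrite inl_loop_vertices vJ.
- by rewrite inr_loop_vertices => LM; apply: negbTE (nz L LM).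
- by move=> _ L'M xL; apply: orth.
- by move=> LM _ yL; rewrite dotC; apply: orth.
Qed.

(** A set dependent in [M] itself has more than three elements or is a triple on a line, orthogonal
    to the nonzero normal of that line. *)
Lemma dependent_realization J v A : levi_realization J v -> dependent (set_loops M J) A ->
  lin_dependent (points_mx v) A.
Proof.
move=> [nz orth]; rewrite /dependent loops_indepE negb_and => /orP[dA | ]; last first.
  rewrite -setI_eq0 => /set0Pn[x /setIP[xA xJ]]; apply: (lin_dependent0 xA).
  by rewrite row_points_mx; apply/eqP; rewrite nz ?inl_loop_vertices // !inE.
have [A3|A3] := ltnP 3 #|A|; first exact: lin_dependent_gt3.
have {}A3 : #|A| = 3 by apply/eqP; rewrite eqn_leq A3 (dependent_card simpleM dA).
have [L LM sAL] := dependent3_line simpleM A3 dA.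
have LD : inr L \in vert [set: 'I_d] (lines M) by rewrite in_vert_line.
apply: (@lin_dependent3 _ _ _ _ (v (inr L))) => //.
  by rewrite nz // inr_loop_vertices.
move=> a aA; rewrite row_points_mx; apply: orth => //=; first by rewrite !inE.
exact: (subsetP sAL).
Qed.

Lemma circuit_variety_plane (g : 'M[F]_(d, 3)) :
  (forall A, dependent M A -> lin_dependent g A) ->
  exists H : {set 'I_d} -> 'rV[F]_3, forall L, L \in lines M ->
    H L != 0 /\ forall i, i \in L -> dot (row i g) (H L) = 0.
Proof.
move=> gM.
have /choice[H HP] : forall L, exists w, L \in lines M ->
    w != 0 /\ forall i, i \in L -> dot (row i g) w = 0.
  move=> L; have [LM | _] := boolP (L \in lines M); last by exists 0.
  have [|w w0 wL] := @plane_exists _ _ g L; last by exists w.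
  by move=> C sCL C3; apply/gM/(line_dependent simpleM LM).
by exists H.
Qed.

(** For at most two points it is enough to single out one. Among three points, a pair on no common
    line is coloured by hand; if all pairs are collinear, the points form a triangle, and the cactus
    structure enters through [cact_colouring]. *)
Lemma indep_colouring A : A \in indep M -> exists chi : 'I_d -> 'I_3,
  {in A &, injective chi} /\
  forall L, L \in lines M -> exists c, {in L, forall w, chi w != c}.
Proof.
move=> iA.
have A3 : (#|A| <= 3)%N by apply: leq_trans rankM; apply: leq_bigmax_cond.
have c01 : (inord 1 == ord0 :> 'I_3) = false by rewrite -val_eqE /= inordK.
have c02 : (inord 2 == ord0 :> 'I_3) = false by rewrite -val_eqE /= inordK.
have c12 : (inord 2 == inord 1 :> 'I_3) = false by rewrite -val_eqE /= !inordK.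
have [A2|A2] := leqP #|A| 2.
  have [->|[x xA]] := set_0Vmem A.
    exists (fun=> ord0); split=> [x y|L _]; first by rewrite inE.
    by exists (inord 1) => w _; rewrite eq_sym c01.
  exists (fun i => if i == x then ord0 else inord 1); split; last first.
    move=> L _; exists (inord 2) => w _.
    by case: (w =P x) => _; rewrite eq_sym ?c02 ?c12.
  move=> y z yA zA; case: (y =P x) => [->|/eqP yx]; case: (z =P x) => [->|/eqP zx] //.
  - by move/eqP; rewrite eq_sym c01.
  - by move/eqP; rewrite c01.
  have Ax : (#|A :\ x| <= 1)%N by move: A2; rewrite (cardsD1 x) xA.
  by move=> _; apply: (card_le1_eq Ax); rewrite !inE ?yx ?zx.
have {A2}A3 : #|A| = 3 by apply/eqP; rewrite eqn_leq A3.
have /card_gt2P[x [y [z [[xA yA zA] [xy yz zx]]]]] : (2 < #|A|)%N by rewrite A3.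
have AE : A = [set x; y; z].
  apply/esym/eqP; rewrite eqEcard !subUset !sub1set xA yA zA A3.
  by rewrite setUC cardsU1 cards2 !inE negb_or zx eq_sym yz xy.
have nocol L : L \in lines M -> x \in L -> y \in L -> z \in L -> False.
  move=> LM xL yL zL; have := line_dependent simpleM LM (C := A).
  by rewrite AE !subUset !sub1set xL yL zL -AE A3 /dependent iA => /(_ isT erefl).
have inj3 (chi : 'I_d -> 'I_3) : chi x != chi y -> chi y != chi z -> chi z != chi x ->
    {in A &, injective chi}.
  move=> cxy cyz czx a b; rewrite AE !inE => /orP[/orP[]|] /eqP-> /orP[/orP[]|] /eqP-> // E.
  - by rewrite E eqxx in cxy.
  - by rewrite E eqxx in czx.
  - by rewrite E eqxx in cxy.
  - by rewrite E eqxx in cyz.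
  - by rewrite E eqxx in czx.
  - by rewrite E eqxx in cyz.
pose col a b := [exists L in lines M, (a \in L) && (b \in L)].
(* If y and z are not collinear, every other point may share the colour of x. *)
have apart a b c : a != b -> b != c -> c != a -> ~~ col b c ->
    exists chi : 'I_d -> 'I_3, [/\ chi a != chi b, chi b != chi c, chi c != chi a &
    forall L, L \in lines M -> exists c, {in L, forall w, chi w != c}].
  move=> ab bc ca nbc.
  pose chi i : 'I_3 := if i == b then inord 1 else if i == c then inord 2 else ord0.
  exists chi; split.
  - by rewrite /chi (negPf ab) (eq_sym a) (negPf ca) eqxx eq_sym c01.
  - by rewrite /chi eqxx (eq_sym c) (negPf bc) eqxx eq_sym c12.
  - by rewrite /chi (eq_sym c b) (negPf bc) eqxx (negPf ab) (eq_sym a) (negPf ca) c02.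
  move=> L LM; have [bL|bL] := boolP (b \in L).
    exists (inord 2) => w wL; rewrite /chi; case: (w =P b) => [_|_]; first by rewrite eq_sym c12.
    case: (w =P c) => [wc|_]; last by rewrite eq_sym c02.
    by case/negP: nbc; apply/exists_inP; exists L; rewrite // bL -wc.
  exists (inord 1) => w wL; rewrite /chi; case: (w =P b) => [wb|_]; first by rewrite -wb wL in bL.
  by case: (w =P c) => _; rewrite ?c12 // eq_sym c01.
have [/exists_inP[Lyz LMyz /andP[yLyz zLyz]] | nyz] := boolP (col y z); last first.
  by have [chi [? ? ? ?]] := apart x y z xy yz zx nyz; exists chi; split=> //; apply: inj3.
have [/exists_inP[Lxz LMxz /andP[zLxz xLxz]] | nzx] := boolP (col z x); last first.
  by have [chi [? ? ? ?]] := apart y z x yz zx xy nzx; exists chi; split=> //; apply: inj3.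
have [/exists_inP[Lxy LMxy /andP[xLxy yLxy]] | nxy] := boolP (col x y); last first.
  by have [chi [? ? ? ?]] := apart z x y zx xy yz nxy; exists chi; split=> //; apply: inj3.
have [||||||||||||chi [cx cy cz cL]] :=
    @cact_colouring _ _ _ x y z Lxy Lxz Lyz cactM; rewrite //.
- by apply/negP; apply: nocol.
- by apply/negP => yL; apply: (nocol Lxz).
- by apply/negP => xL; apply: (nocol Lyz).
by exists chi; split=> //; apply: inj3; rewrite ?cx ?cy ?cz ?c02 // eq_sym ?c01 ?c12.
Qed.

(** A point gets the basis vector of its colour and a line that of a missing colour. The points of
    [A] avoid [J] and have distinct colours, so their vectors are dual to themselves. *)
Lemma indep_witness J A : A \in indep (set_loops M J) ->
  exists2 v, levi_realization J v & ~~ lin_dependent (points_mx v) A.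
Proof.
rewrite loops_indepE => /andP[iA dis].
have [chi [chi_inj missing]] := indep_colouring iA.
have /choice[miss missP] : forall L, exists c, L \in lines M -> {in L, forall w, chi w != c}.
  move=> L; have [/missing[c cP] | _] := boolP (L \in lines M); last by exists ord0.
  by exists c.
pose e (c : 'I_3) : 'rV[F]_3 := delta_mx 0 c.
have e0 c : e c != 0.
  by apply/eqP => /rowP/(_ c)/eqP; rewrite !mxE !eqxx oner_eq0.
have dotE (a b : 'I_3) : dot (e a) (e b) = (a == b)%:R.
  rewrite /dot !mxE !eqxx /= -!natrM -!natrD; congr (_%:R).
  by move: a b => [[|[|[|//]]] ?] [[|[|[|//]]] ?].
pose v (u : V) := match u with
  | inl x => if x \in J then 0 else e (chi x) | inr L => e (miss L) end.
exists v.
  apply: realizationP => [x | L LM | x L LM xL] /=; rewrite ?e0 //.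
    by case: ifP => _; rewrite ?eqxx ?(negPf (e0 _)).
  by case: ifP => _; rewrite ?dot0l // dotE (negPf (missP L LM x xL)).
have nJ a : a \in A -> (a \in J) = false by move=> aA; apply: disjointFr dis aA.
apply: free_dual => a aA; exists (e (chi a)); rewrite row_points_mx /= nJ // dotE eqxx oner_eq0.
split=> // b bA ba; rewrite row_points_mx /= nJ // dotE (_ : (_ == _) = false) //.
by apply: contraNF ba => /eqP /chi_inj ->.
Qed.

Lemma irr_levi_realization J : irr (levi_realization J).
Proof. exact: buildable_irr (@levi_sym _) (@levi_irr _) (cact_buildable cactM). Qed.

(** Each independent set of [M(J)] is an open condition, satisfied somewhere by [indep_witness];
    irreducibility satisfies these finitely many conditions together with [P]. *)
Lemma generic_realization J v (P : {mpoly F[d * 3]}) : levi_realization J v ->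
  P.@[mxvec (points_mx v) 0] != 0 ->
  exists g, P.@[mxvec g 0] != 0 /\
    forall A, dependent (set_loops M J) A <-> lin_dependent g A.
Proof.
move=> Jv Pv.
have /choice[f fP] : forall A, exists Q : {mpoly F[d * 3]}, A \in indep (set_loops M J) ->
    (exists2 v, levi_realization J v & Q.@[mxvec (points_mx v) 0] != 0) /\
    forall h, Q.@[mxvec h 0] != 0 -> ~~ lin_dependent h A.
  move=> A; have [/indep_witness[w Jw fw] | _] := boolP (A \in _); last by exists 0.
  by have [Q [Qw QP]] := free_minor fw; exists Q => _; split=> //; exists w.
pose s := enum (indep (set_loops M J)).
have [||||w Jw fw] :=
    @irr_prod (levi_realization J) _ s (fun A v => (f A).@[mxvec (points_mx v) 0]).
- exact: irr_levi_realization.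
- by exists v.
- by move=> A; apply: regular_meval.
- by move=> A; rewrite mem_enum => /fP[].
have rprod : regular (fun v => \prod_(A <- s) (f A).@[mxvec (points_mx v) 0]).
  by apply: regular_prod => A; apply: regular_meval.
have [u [Ju Pu fu]] := irr_levi_realization (regular_meval P) rprod Jv Jw Pv fw.
exists (points_mx u); split=> // A; split; first exact: dependent_realization.
apply: contraTT; rewrite /dependent negbK => iA; have [_] := fP A iA; apply.
by move: fu; rewrite prodf_seq_neq0 => /allP/(_ A); rewrite mem_enum; apply.
Qed.

Lemma circuit_variety_adh (g : 'M[F]_(d, 3)) :
  (forall A, dependent M A -> lin_dependent g A) ->
  exists2 J : {set 'I_d}, J \subset Qset M &
    exists2 v, points_mx v = g & adh (levi_realization J) v.
Proof.
move=> gM; have [H HP] := circuit_variety_plane gM.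
pose J := [set x in Qset M | row x g == 0].
exists J; first by apply/subsetP => x; rewrite inE => /andP[].
pose v (u : V) := match u with inl x => row x g | inr L => H L end.
exists v; first by apply/row_matrixP => i; rewrite row_points_mx.
have /choice[w wP] : forall x, exists w : 'rV[F]_3, (x \notin Qset M -> w != 0) /\
    (x \notin Qset M -> forall L, L \in lines M -> x \in L -> dot w (H L) = 0).
  move=> x; have [_|] := boolP (x \in Qset M); first by exists 0.
  rewrite inE -leqNgt /degree => deg2.
  suff [w w0 wL] : exists2 w : 'rV[F]_3, w != 0 & forall L, L \in lines_at M x -> dot w (H L) = 0.
    by exists w; split=> // _ L LM xL; apply: wL; apply/setIdP.
  have [at0|[L1 L1x]] := set_0Vmem (lines_at M x).
    by have [w w0 _] := ex_orth (0 : 'rV[F]_3); exists w => // L; rewrite at0 inE.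
  have le1 : (#|lines_at M x :\ L1| <= 1)%N by move: deg2; rewrite (cardsD1 L1) L1x.
  have [at1|[L2 L2x]] := set_0Vmem (lines_at M x :\ L1).
    have [w w0 wL1] := ex_orth (H L1); exists w => // L Lx; rewrite dotC.
    have : L \notin lines_at M x :\ L1 by rewrite at1 inE.
    by rewrite in_setD1 Lx andbT negbK => /eqP->.
  have [w w0 [wL1 wL2]] := ex_orth2 (H L1) (H L2); exists w => // L Lx; rewrite dotC.
  have [-> // | LL1] := eqVneq L L1.
  by rewrite (card_le1_eq le1 (x := L) (y := L2)) // in_setD1 LL1.
pose z x := if (x \notin Qset M) && (row x g == 0) then w x else 0.
pose c (u : V) := match u with inl x => linev (row x g) (z x) | inr L => cstv (H L) end.
apply: (@adh_curve _ _ _ _ c 0).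
  by apply/funext => -[x|L]; rewrite /evc /= !evE ?scale0r ?addr0.
exists 'X; first by rewrite polyX_eq0.
move=> t; rewrite hornerX => t0; apply: adh_id; apply: realizationP.
- move=> x; have -> : (x \in J) = (x \in Qset M) && (row x g == 0) by rewrite in_set.
  rewrite /evc /= evE /z.
  have [gx|gx] := eqVneq (row x g) 0; rewrite ?andbF ?andbF ?andbT ?andbT.
    case: (boolP (x \in Qset M)) => /= xQ; first by rewrite gx scaler0 addr0 eqxx.
    by rewrite gx add0r scaler_eq0 (negPf t0) (negPf ((wP x).1 xQ)).
  by rewrite scaler0 addr0 (negPf gx).
- by move=> L LM; rewrite /evc /= evE; case: (HP L LM).
- move=> x L LM xL; rewrite /evc /= !evE dotC dotDr dotZr dotC (HP L LM).2 // add0r /z.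
  case: ifP => [/andP[xQ _] | _]; last by rewrite dot0r mulr0.
  by rewrite dotC (wP x).2 // mulr0.
Qed.

(** Since [M] has no loops, singletons are dependent in [M(J)] exactly at [J], which identifies the
    zero vectors. *)
Lemma Gamma_realization J (g : 'M[F]_(d, 3)) :
  (forall A, dependent (set_loops M J) A <-> lin_dependent g A) ->
  exists2 v, points_mx v = g & levi_realization J v.
Proof.
move=> gJ; have [|H HP] := @circuit_variety_plane g.
  by move=> A dA; apply/gJ; move: dA; rewrite /dependent loops_indepE negb_and => ->.
exists (fun u => match u with inl x => row x g | inr L => H L end).
  by apply/row_matrixP => i; rewrite row_points_mx.
apply: realizationP => [x | L /HP[] // | x L /HP[_ HL] /HL //].
have i1 : [set x] \in indep M.
  by apply: contraT => d1; have := dependent_card simpleM d1; rewrite cards1.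
have : dependent (set_loops M J) [set x] = (x \in J).
  by rewrite /dependent loops_indepE i1 disjoints1 negbK.
have [xJ _ | xJ dx] := boolP (x \in J).
  apply: contraT => gx.
  suff : ~~ lin_dependent g [set x].
    by case/negP; apply/gJ; rewrite /dependent loops_indepE i1 disjoints1 negbK.
  apply: free_dual => a; rewrite inE => /eqP->; have [w0 hw] := dot_neq0 gx.
  by exists w0; split=> // b; rewrite inE => ->.
apply/negbTE/negP => /eqP gx; have : lin_dependent g [set x].
  by apply: (@lin_dependent0 _ _ _ _ x); rewrite ?inE.
by move/gJ; rewrite dx.
Qed.

End Realizations.

(** * Irreducible components *)

(* Imported only here: classical_sets shadows finset names. *)
From mathcomp Require Import classical_sets functions cardinality reals.
From mathcomp Require Import complex.
Local Open Scope ring_scope.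
Local Open Scope classical_set_scope.
Local Open Scope card_scope.

Section Zariski.
Variables (F : fieldType) (d : nat).
Implicit Types (X Y Z : set 'M[F]_(d, 3)).

Lemma zariski_closureE X : zariski_closure X =
  zero_locus [set P | forall g, X g -> P.@[mxvec g 0] = 0].
Proof.
rewrite eqEsubset; split; first by apply: smallest_sub; [eexists | move=> g Xg P; apply].
by move=> g gX _ [[S ->] XS] P SP; apply: gX => h /XS; apply.
Qed.

Lemma closed_zariski_closure X : zariski_closed (zariski_closure X).
Proof. by rewrite zariski_closureE; eexists. Qed.

Lemma zariski_closureP X g : zariski_closure X g <->
  forall P : {mpoly F[d * 3]}, P.@[mxvec g 0] != 0 -> exists2 h, X h & P.@[mxvec h 0] != 0.
Proof.
rewrite zariski_closureE; split=> [gX P Pg | gX P PX].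
  apply: contrapT => noh; case/eqP: Pg; apply: gX => h Xh; apply/eqP.
  by apply: contraT => Ph; case: noh; exists h.
by apply/eqP; apply: contraT => /gX[h /PX->]; rewrite eqxx.
Qed.

Lemma zariski_closed0 : zariski_closed (set0 : set 'M[F]_(d, 3)).
Proof.
exists setT; rewrite eqEsubset; split=> // g /(_ 1 I); rewrite meval1 => /eqP.
by rewrite oner_eq0.
Qed.

Lemma zariski_closedU Y Z : zariski_closed Y -> zariski_closed Z -> zariski_closed (Y `|` Z).
Proof.
move=> [S ->] [S' ->].
exists [set R | exists P Q, [/\ S P, S' Q & R = P * Q]]; rewrite eqEsubset; split=> g.
  by case=> gS _ [P [Q [SP S'Q ->]]]; rewrite mevalM ?(gS P SP) ?(gS Q S'Q) ?mul0r ?mulr0.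
move=> gSS'; have [gS | ngS] := pselect (zero_locus S g); [by left | right].
move/existsNP: ngS => [P /not_implyP[SP Pg]] Q S'Q.
have := gSS' (P * Q); rewrite mevalM => /(_ _)/eqP; rewrite mulf_eq0.
case/(_ _)/orP; [by exists P, Q | by move/eqP | by move/eqP].
Qed.

Lemma irreducible_subset_seq (I : eqType) X (s : seq I) (Y : I -> set 'M[F]_(d, 3)) :
  irreducible_set X -> (forall i, zariski_closed (Y i)) ->
  X `<=` [set g | exists2 i, i \in s & Y i g] -> exists2 i, i \in s & X `<=` Y i.
Proof.
move=> [[g0 Xg0] irrX] cY.
have cU (t : seq I) : zariski_closed [set g | exists2 i, i \in t & Y i g].
  elim: t => [|i t IH].
    rewrite (_ : [set g | _] = set0); first exact: zariski_closed0.
    by rewrite eqEsubset; split=> // g [j].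
  rewrite (_ : [set g | _] = Y i `|` [set g | exists2 i, i \in t & Y i g]).
    exact: zariski_closedU.
  rewrite eqEsubset; split=> g /=.
    by case=> j; rewrite inE => /predU1P[-> ? | jt ?]; [left | right; exists j].
  case=> [Yg | [j jt Yg]]; first by exists i; rewrite ?mem_head.
  by exists j; rewrite // inE jt orbT.
elim: s => [/(_ g0 Xg0)[j] // | i s IH sX].
have [|XYi|XU] := irrX (Y i) [set g | exists2 i, i \in s & Y i g] (cY i) (cU s).
- move=> g /sX[j]; rewrite inE => /predU1P[-> ? | js ?]; [by left | by right; exists j].
- by exists i; rewrite ?mem_head.
by have [j js XYj] := IH XU; exists j; rewrite // inE js orbT.
Qed.

Lemma closed_circuit_variety (M : matroid 'I_d) : zariski_closed (circuit_variety F M).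
Proof.
suff <- : zariski_closure (circuit_variety F M) = circuit_variety F M.
  exact: closed_zariski_closure.
rewrite eqEsubset; split; last exact: sub_gen_smallest.
move=> g /zariski_closureP gX A dA; apply: contraT => fr.
have [P [Pg Pfr]] := free_minor fr.
by have [h hM Ph] := gX P Pg; have := Pfr h Ph; rewrite hM.
Qed.

End Zariski.

Section CircuitVariety.
Variables (F : numFieldType) (d : nat) (M : matroid 'I_d).
Hypotheses (simpleM : simple_matroid M) (rankM : (rank M <= 3)%N).
Hypothesis cactM : cact [set: 'I_d]%SET (lines M).
Implicit Types J : {set 'I_d}.

Lemma Gamma_circuit_variety J :
  Gamma F (set_loops M J) `<=` circuit_variety F M.
Proof.
by move=> g gJ A dA; apply/gJ; move: dA; rewrite /dependent loops_indepE negb_and => ->.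
Qed.

Lemma matroid_variety_sub J :
  matroid_variety F (set_loops M J) `<=` circuit_variety F M.
Proof.
by apply: smallest_sub; [apply: closed_circuit_variety | apply: Gamma_circuit_variety].
Qed.

Lemma matroid_variety_realization J v : levi_realization M J v ->
  matroid_variety F (set_loops M J) (points_mx v).
Proof.
move=> Jv; apply/zariski_closureP => P Pv.
by have [g [Pg gJ]] := generic_realization simpleM rankM cactM Jv Pv; exists g.
Qed.

Lemma circuit_variety_cover (g : 'M[F]_(d, 3)) : circuit_variety F M g ->
  exists2 J : {set 'I_d}, J \subset Qset M & matroid_variety F (set_loops M J) g.
Proof.
move=> gM; have [J JQ [v <- vJ]] := circuit_variety_adh simpleM gM; exists J => //.
apply/zariski_closureP => P Pv.
have [w /(matroid_variety_realization) wJ Pw] := vJ _ (regular_meval P) Pv.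
exact: (zariski_closureP _ _).1 wJ P Pw.
Qed.

(** A polynomial that is nonzero somewhere on the closure is nonzero somewhere on [Gamma], hence at
    a realization; [irr_levi_realization] then gives one realization outside both closed sets. *)
Lemma matroid_variety_irreducible J :
  matroid_variety F (set_loops M J) !=set0 ->
  irreducible_set (matroid_variety F (set_loops M J)).
Proof.
move=> V0; split=> // _ _ [S1 ->] [S2 ->] VYZ.
have [V1|/existsNP[g1 /not_implyP[Vg1 /existsNP[P1 /not_implyP[SP1 /eqP Pg1]]]]] :=
  pselect (matroid_variety F (set_loops M J) `<=` zero_locus S1); first by left.
right=> g2 Vg2 P2 SP2; apply/eqP; apply: contraT => Pg2; exfalso.
have [h1 /(Gamma_realization simpleM)[v1 <- Jv1] Ph1] := (zariski_closureP _ _).1 Vg1 P1 Pg1.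
have [h2 /(Gamma_realization simpleM)[v2 <- Jv2] Ph2] := (zariski_closureP _ _).1 Vg2 P2 Pg2.
have [v [Jv P1v P2v]] :=
  irr_levi_realization cactM (regular_meval P1) (regular_meval P2) Jv1 Jv2 Ph1 Ph2.
by case: (VYZ _ (matroid_variety_realization Jv)) => [/(_ _ SP1) | /(_ _ SP2)] /eqP; apply/negP.
Qed.

(** Finitely many closed sets cover the component, so one contains it; being irreducible and inside
    the circuit variety, that one equals the component by maximality. *)
Lemma irreducible_component_matroid_variety X :
  irreducible_components (circuit_variety F M) X ->
  exists2 J : {set 'I_d}, J \subset Qset M & X = matroid_variety F (set_loops M J).
Proof.
move=> [irrX XM maxX].
have [|||J] := @irreducible_subset_seq _ _ _ X (enum (powerset (Qset M)))
    (fun J => matroid_variety F (set_loops M J)) => //.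
- by move=> J; apply: closed_zariski_closure.
- move=> g /XM/circuit_variety_cover[J JQ gJ]; exists J => //.
  by rewrite mem_enum powersetE.
rewrite mem_enum powersetE => JQ XJ; exists J => //; apply/esym/maxX => //.
  apply: matroid_variety_irreducible; have [[g Xg] _] := irrX.
  by exists g; apply: XJ.
exact: matroid_variety_sub.
Qed.

End CircuitVariety.

Theorem theorem3p18 (R : realType) (d : nat) (M : matroid 'I_d)
    (cactusM : cactus M) :
  irreducible_components (circuit_variety R[i] M) #<= `I_(2 ^ #|Qset M|) /\
  forall X : set 'M[R[i]]_(d, 3),
    irreducible_components (circuit_variety R[i] M) X ->
    exists2 J : {set 'I_d}, J \subset Qset M &
      X = matroid_variety R[i] (set_loops M J).
Proof.
have [/andP[simpleM rankM] compM] := cactusM.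
have cactM := cactus_cact simpleM compM.
have comp X : irreducible_components (circuit_variety R[i] M) X ->
    exists2 J : {set 'I_d}, J \subset Qset M & X = matroid_variety R[i] (set_loops M J).
  exact: irreducible_component_matroid_variety.
split=> //; pose s := enum (powerset (Qset M)).
(* Subsets of [Qset M] are numbered by their position in [s], whose length is the bound; the default
   of [nth] is not reached at the positions used. *)
pose f k := matroid_variety R[i] (set_loops M (nth finset.set0 s k)).
apply: card_le_trans (card_image_le f `I_(2 ^ #|Qset M|)); apply: subset_card_le.
move=> X /comp[J JQ ->]; exists (index J s); last by rewrite /f nth_index // mem_enum powersetE.
by rewrite /= -card_powerset cardE index_mem mem_enum powersetE.
Qed.
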